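(* Every set $X\subseteq\{0,1\}^*$ that is decided by some CFpoly program belongs to $\mathrm{NSPACE}(\log^2 n)$.
   Context: CF (''cons-free'') is a first-order, call-by-value functional language over booleans and bit lists $\{0,1\}^*$. A program is a finite sequence of mutually recursive function definitions $\mathtt{f\ x1 \dots xm = e}$ ($m\ge0$), the first being a one-argument entry function. Expressions are $\mathtt{True}$, $\mathtt{False}$, $\mathtt{[]}$, variables, base calls $\mathtt{not\ e}$, $\mathtt{null\ e}$, $\mathtt{head\ e}$, $\mathtt{tail\ e}$, conditionals $\mathtt{if\ e_0\ then\ e_1\ else\ e_2}$, and calls $\mathtt{f\ e_1\dots e_m}$ of defined functions; there are no list constructors. Semantics is standard big-step call-by-value evaluation given by inference rules deriving $\mathtt{p},\rho\vdash\mathtt{e}\to v$; the derivation tree for the run on input $x$ is the computation tree $\mathcal{T}^{\mathtt{p},x}$, and the native running time $\mathit{time}_{\mathtt{p}}(x)$ is its number of nodes. A program $\mathtt{p}$ decides $X$ if it terminates on all inputs and returns $1$ (True) on $x\in X$ and $0$ (False) on $x\notin X$. CFpoly is the class of CF programs that terminate in polynomial native time. $\mathrm{NSPACE}(\log^2 n)$ is the class of sets decidable by a nondeterministic Turing machine with read-only input using $O(\log^2 n)$ work space on inputs of length $n$. *)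

(* Defs.v *)
From Stdlib Require Import List Arith PeanoNat Relations.
Import ListNotations.

Inductive val : Type :=
| VB : bool -> val
| VL : list bool -> val.

(** Expressions.  Variables are de Bruijn indices into the list of
    parameters of the enclosing function; defined functions are referred
    to by their position in the program. *)
Inductive expr : Type :=
| ETrue : expr
| EFalse : expr
| ENil : expr
| EVar : nat -> expr
| ENot : expr -> expr
| ENull : expr -> expr
| EHead : expr -> expr
| ETail : expr -> expr
| EIf : expr -> expr -> expr -> expr
| ECall : nat -> list expr -> expr.

(** A program: a finite sequence of function definitions
    [f x1 ... xm = e], each given as its arity [m] and body [e]. *)
Definition program := list (nat * expr).

Fixpoint wf_expr (p : program) (m : nat) (e : expr) : Prop :=
  match e with
  | ETrue | EFalse | ENil => True
  | EVar i => i < m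
  | ENot e | ENull e | EHead e | ETail e => wf_expr p m e
  | EIf e0 e1 e2 => wf_expr p m e0 /\ wf_expr p m e1 /\ wf_expr p m e2
  | ECall f es =>
      (match nth_error p f with
       | Some (k, _) => length es = k
       | None => False
       end) /\
      (fix wfl (es : list expr) : Prop :=
         match es with
         | [] => True
         | e :: es => wf_expr p m e /\ wfl es
         end) es
  end.

Definition wf_program (p : program) : Prop :=
  (exists body, nth_error p 0 = Some (1, body)) /\
  (forall f m body, nth_error p f = Some (m, body) -> wf_expr p m body).

(** Big-step call-by-value semantics.  [eval p rho e v t] means that the
    judgement [p, rho |- e -> v] is derivable by a derivation tree with
    exactly [t] nodes (each inference rule contributes one node).
    [evals] evaluates argument lists; its [t] is the total number of nodes
    of the argument subderivations. *)
Inductive eval (p : program) : list val -> expr -> val -> nat -> Prop :=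
| ev_true : forall rho, eval p rho ETrue (VB true) 1
| ev_false : forall rho, eval p rho EFalse (VB false) 1
| ev_nil : forall rho, eval p rho ENil (VL []) 1
| ev_var : forall rho i v, nth_error rho i = Some v -> eval p rho (EVar i) v 1
| ev_not : forall rho e b t,
    eval p rho e (VB b) t -> eval p rho (ENot e) (VB (negb b)) (S t)
| ev_null_nil : forall rho e t,
    eval p rho e (VL []) t -> eval p rho (ENull e) (VB true) (S t)
| ev_null_cons : forall rho e b l t,
    eval p rho e (VL (b :: l)) t -> eval p rho (ENull e) (VB false) (S t)
| ev_head : forall rho e b l t,
    eval p rho e (VL (b :: l)) t -> eval p rho (EHead e) (VB b) (S t)
| ev_tail : forall rho e b l t,
    eval p rho e (VL (b :: l)) t -> eval p rho (ETail e) (VL l) (S t)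
| ev_if_true : forall rho e0 e1 e2 v t0 t1,
    eval p rho e0 (VB true) t0 -> eval p rho e1 v t1 ->
    eval p rho (EIf e0 e1 e2) v (S (t0 + t1))
| ev_if_false : forall rho e0 e1 e2 v t0 t2,
    eval p rho e0 (VB false) t0 -> eval p rho e2 v t2 ->
    eval p rho (EIf e0 e1 e2) v (S (t0 + t2))
| ev_call : forall rho f es m body vs v ts tb,
    nth_error p f = Some (m, body) ->
    length es = m ->
    evals p rho es vs ts ->
    eval p vs body v tb ->
    eval p rho (ECall f es) v (S (ts + tb))
with evals (p : program) : list val -> list expr -> list val -> nat -> Prop :=
| evs_nil : forall rho, evals p rho [] [] 0
| evs_cons : forall rho e es v vs t ts,
    eval p rho e v t -> evals p rho es vs ts ->
    evals p rho (e :: es) (v :: vs) (t + ts).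

Definition cf_run (p : program) (x : list bool) (v : val) (t : nat) : Prop :=
  exists body, nth_error p 0 = Some (1, body) /\ eval p [VL x] body v t.

Definition cf_decides (p : program) (X : list bool -> Prop) : Prop :=
  forall x, exists v t, cf_run p x v t /\
    (X x -> v = VB true) /\ (~ X x -> v = VB false).

Definition cf_poly (p : program) : Prop :=
  exists c k, forall x, exists v t, cf_run p x v t /\ t <= c * length x ^ k + c.

Inductive dir : Type := DLeft | DStay | DRight.

(** Transition: in state [tq], reading [tin] on the input tape
    ([None] = end marker) and [tw] on the work tape, go to state [tq'],
    write [twr] on the work tape, move the heads. States and work symbols
    are natural numbers; the finite transition list makes both finite.
    Work symbol 0 is the blank. *)
Record trans : Type := mkTrans {
  tq : nat; tin : option bool; tw : nat;
  tq' : nat; twr : nat; tim : dir; twm : dir }.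

Record ntm : Type := mkNTM {
  start : nat; accept : nat; delta : list trans }.

Record config : Type := mkConfig {
  cq : nat;
  ci : nat;          (* input head position, 0 .. n+1 (0, n+1 = end markers) *)
  cw : list nat;     (* work tape contents (blank-padded to the right) *)
  ch : nat }.

Definition input_sym (x : list bool) (i : nat) : option bool :=
  match i with 0 => None | S j => nth_error x j end.

Definition move_in (n i : nat) (d : dir) : nat :=
  match d with DLeft => pred i | DStay => i | DRight => Nat.min (S i) (S n) end.

Definition move_w (h : nat) (d : dir) : nat :=
  match d with DLeft => pred h | DStay => h | DRight => S h end.

Fixpoint write_w (w : list nat) (h s : nat) : list nat :=
  match w, h with
  | [], 0 => [s]
  | [], S h => 0 :: write_w [] h s
  | _ :: w, 0 => s :: w
  | a :: w, S h => a :: write_w w h s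
  end.

Definition step (M : ntm) (x : list bool) (c c' : config) : Prop :=
  exists t, In t (delta M) /\ tq t = cq c /\ tin t = input_sym x (ci c) /\
    tw t = nth (ch c) (cw c) 0 /\
    c' = mkConfig (tq' t) (move_in (length x) (ci c) (tim t))
                  (write_w (cw c) (ch c) (twr t)) (move_w (ch c) (twm t)).

Definition init_config (M : ntm) : config := mkConfig (start M) 0 [] 0.

Definition reachable (M : ntm) (x : list bool) (c : config) : Prop :=
  clos_refl_trans config (step M x) (init_config M) c.

(** Work space used by a configuration (cells written or visited). *)
Definition space (c : config) : nat := Nat.max (length (cw c)) (S (ch c)).

Definition ntm_decides_in_space (M : ntm) (s : nat -> nat) (X : list bool -> Prop) : Prop :=
  forall x,
    (forall c, reachable M x c -> space c <= s (length x)) /\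
    (X x <-> exists c, reachable M x c /\ cq c = accept M).

Definition in_NSPACE_log2sq (X : list bool -> Prop) : Prop :=
  exists (M : ntm) (c : nat),
    ntm_decides_in_space M (fun n => c * Nat.log2 n ^ 2 + c) X.

(* Main.v *)
Require Import Defs.
From Stdlib Require Import List Arith PeanoNat Lia Relations Classical.
Import ListNotations.

(* Every list that a cons-free program computes is a suffix of the input, so a value is a boolean or a position of O(log n) bits, and a judgement "e evaluates to v in environment rho" fits in O(log n) bits. A nondeterministic machine searches for a derivation with a stack of judgements: it guesses the intermediate values of a rule and replaces the judgement by the premises of that rule. If the smaller premises are verified first and the largest one reuses the frame of the conclusion, a derivation of polynomial size needs only O(log n) frames. Since every accepting search yields a derivation, the machine needs no clock; its space is bounded by a tape laid out beforehand.

The stack is stored by columns: column c holds the c-th binary digit of every register of every frame, topmost frame first. Each stack operation is then a single left-to-right pass of a finite transducer over the tape. A tape of length of order (log n)^2 is obtained by counting n in binary on w cells and then appending one cell for each step of an odometer with two digits of size O(w). Positions are only ever guessed as the current position of the input head, which is tracked by a binary register. *)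

(** Deciding in bounded space constrains every reachable configuration, those of wrong guesses
    included, so the bound may not rest on lucky choices. Once the columns are marked the tape never
    grows, and an operation that would overflow a column blocks its run. When growth stops, and
    where columns begin, is guessed freely: soundness holds for every layout, completeness picks
    one.

    The number of frames comes from halving. Of two pending premises the smaller has at most half of
    the nodes of their conclusion, so each new frame costs a factor two in size, and [log2 t] is
    O(log n) for polynomial [t]. For time at most [c * n ^ k + c], the value [K = 2 * c + k + 4]
    makes the full odometer supply [w] columns of [K * K * w] cells, and each column needs only
    [log2 t + 4].

    Evaluation is deterministic, so a derivation of True found on any branch is the answer of the
    program, and rejection needs no certificate. *)

#[local] Open Scope bool_scope.

(** * Finite predicates *)

Definition finite_pred {A : Type} (P : A -> Prop) : Prop :=
  exists l, forall a, P a -> In a l.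

(** [delta] must be a list, whereas transitions are specified by a proposition. A covering list is
    filtered classically; exactness serves both directions of the simulation. *)
Lemma finite_pred_exact {A : Type} (P : A -> Prop) :
  finite_pred P -> exists l, forall a, In a l <-> P a.
Proof.
  intros [l Hl].
  assert (H : exists l', forall a, In a l' <-> In a l /\ P a).
  { clear Hl. induction l as [|b l [l' IH]].
    - exists []. simpl. tauto.
    - destruct (classic (P b)) as [Hb|Hb].
      + exists (b :: l'). intros a. simpl. rewrite IH. intuition congruence.
      + exists l'. intros a. simpl. rewrite IH. intuition congruence. }
  destruct H as [l' H]. exists l'. intros a. rewrite H. firstorder.
Qed.

Lemma finite_pred_image {A B : Type} (P : A -> Prop) (R : B -> Prop) (f : A -> B) :
  finite_pred P -> (forall b, R b -> exists a, P a /\ f a = b) -> finite_pred R.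
Proof.
  intros [l Hl] H. exists (map f l). intros b Hb.
  destruct (H b Hb) as [a [Ha <-]]. apply in_map. auto.
Qed.

Lemma finite_pred_prod {A B : Type} (P : A -> Prop) (R : B -> Prop) :
  finite_pred P -> finite_pred R -> finite_pred (fun ab => P (fst ab) /\ R (snd ab)).
Proof.
  intros [l Hl] [l' Hl']. exists (list_prod l l'). intros [a b] [Ha Hb].
  apply in_prod; auto.
Qed.

Lemma finite_pred_le (n : nat) : finite_pred (fun i => i <= n).
Proof. exists (seq 0 (S n)). intros a H. apply in_seq. lia. Qed.

Lemma finite_bool : finite_pred (fun _ : bool => True).
Proof. exists [true; false]. intros []; simpl; auto. Qed.

Lemma finite_dir : finite_pred (fun _ : dir => True).
Proof. exists [DLeft; DStay; DRight]. intros []; simpl; auto. Qed.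

Lemma finite_option {A : Type} (P : A -> Prop) :
  finite_pred P -> finite_pred (fun o => forall a, o = Some a -> P a).
Proof.
  intros [l Hl]. exists (None :: map Some l). intros [a|] H; simpl; auto.
  right. apply in_map. auto.
Qed.

Lemma finite_lists {A : Type} (P : A -> Prop) (n : nat) :
  finite_pred P -> finite_pred (fun l => length l <= n /\ Forall P l).
Proof.
  intros HP. induction n as [|n IH].
  - exists [[]]. intros [|a l] [H _]; simpl in *; [auto|lia].
  - destruct (finite_pred_prod _ _ HP IH) as [L HL].
    exists ([] :: map (fun al => fst al :: snd al) L).
    intros [|a l] [H1 H2]; simpl in *; auto. right.
    inversion H2; subst.
    apply (in_map (fun al => fst al :: snd al) L (a, l)).
    apply HL; simpl; repeat split; auto; lia.
Qed.

(** * Sweep machines *)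

Section Sweep.

(* A sweep machine owns a tape word. One macro step runs a nondeterministic letter-to-letter transducer [mst] from left to right over the whole word; at the right end [mend] reads the input symbol, may append one letter, and moves the input head. *)
Variables (Q G : Type).
Variable mst : Q -> G -> G -> Q -> Prop.
Variable mend : Q -> option bool -> option G -> dir -> Q -> Prop.
Variables q0 qacc : Q.

Inductive run : Q -> list G -> list G -> Q -> Prop :=
| run_nil q : run q [] [] q
| run_cons q a b q' u v q'' :
    mst q a b q' -> run q' u v q'' -> run q (a :: u) (b :: v) q''.

Definition optl (o : option G) : list G :=
  match o with Some g => [g] | None => [] end.

Definition sconf : Type := (Q * nat * list G)%type.

Inductive sstep (x : list bool) : sconf -> sconf -> Prop :=
| sstep_intro q i u v r o d q' :
    run q u v r -> mend r (input_sym x i) o d q' ->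
    sstep x (q, i, u) (q', move_in (length x) i d, v ++ optl o).

Definition sreach (x : list bool) (c : sconf) : Prop :=
  clos_refl_trans _ (sstep x) (q0, 0, []) c.

Lemma run_length q u v r : run q u v r -> length v = length u.
Proof. induction 1; simpl; auto. Qed.

Lemma run_app q u v r u' v' r' :
  run q u v r -> run r u' v' r' -> run q (u ++ u') (v ++ v') r'.
Proof. induction 1; simpl; auto. intros. econstructor; eauto. Qed.

Lemma run_app_inv q u u' w r :
  run q (u ++ u') w r ->
  exists v v' s, w = v ++ v' /\ run q u v s /\ run s u' v' r.
Proof.
  revert q w. induction u as [|a u IH]; simpl; intros q w H.
  - exists [], w, q. repeat split; auto. constructor.
  - inversion H; subst. destruct (IH _ _ H6) as (v1 & v' & s & -> & H1 & H2).
    exists (b :: v1), v', s. repeat split; auto. econstructor; eauto.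
Qed.

Variables (lQ : list Q) (lG : list G).
Hypothesis mst_fin : forall q a b q', mst q a b q' -> In b lG /\ In q' lQ.
Hypothesis mend_fin : forall q s o d q',
  mend q s o d q' -> (forall g, o = Some g -> In g lG) /\ In q' lQ.
Hypothesis q0_in : In q0 lQ.
Hypothesis qacc_in : In qacc lQ.

(** Each sweep state has two copies, one for sweeping right and one for rewinding. Parity tells them
    apart, and 0 stays free for the start state. *)
Definition fwd (k : nat) : nat := 2 * k + 1.
Definition rew (k : nat) : nat := 2 * k + 2.

(* Work symbols: 0 is blank, 1 marks the left end, [j + 2] is the j-th letter. *)
Definition sym (k : nat) (a : G) : Prop := exists j, k = j + 2 /\ nth_error lG j = Some a.
Definition wsym (k : nat) (o : option G) : Prop :=
  match o with None => k = 0 | Some a => sym k a end.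

(** The blank after the last letter triggers [T_end], the only transition that depends on the input
    symbol; the others are present for every [s]. The marker 1 in cell 0 stops the rewinding. *)
Inductive trans_ok : trans -> Prop :=
| T_start s k : nth_error lQ k = Some q0 ->
    trans_ok (mkTrans 0 s 0 (rew k) 1 DStay DStay)
| T_fwd s k j k' j' q a b q' :
    nth_error lQ k = Some q -> sym j a -> nth_error lQ k' = Some q' -> sym j' b ->
    mst q a b q' ->
    trans_ok (mkTrans (fwd k) s j (fwd k') j' DStay DRight)
| T_end s k q k' q' w o d :
    nth_error lQ k = Some q -> nth_error lQ k' = Some q' -> wsym w o ->
    mend q s o d q' ->
    trans_ok (mkTrans (fwd k) s 0 (rew k') w d DLeft)
| T_rew s k q j a : nth_error lQ k = Some q -> sym j a ->
    trans_ok (mkTrans (rew k) s j (rew k) j DStay DLeft)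
| T_turn s k q : nth_error lQ k = Some q ->
    trans_ok (mkTrans (rew k) s 1 (fwd k) 1 DStay DRight).

Lemma nth_error_lt {A : Type} (l : list A) k a : nth_error l k = Some a -> k < length l.
Proof. intros H. apply nth_error_Some. congruence. Qed.

Lemma trans_ok_finite : finite_pred trans_ok.
Proof.
  set (B := 2 * length lQ + length lG + 5).
  pose proof (finite_pred_le B) as HB.
  pose proof (finite_option _ finite_bool) as Ho.
  pose proof finite_dir as Hd.
  eapply finite_pred_image with
    (f := fun p : (nat * option bool * nat) * (nat * nat * (dir * dir)) =>
      let '((a, s, b), (a', b', (d, d'))) := p in mkTrans a s b a' b' d d').
  - exact (finite_pred_prod _ _ (finite_pred_prod _ _ (finite_pred_prod _ _ HB Ho) HB)
      (finite_pred_prod _ _ (finite_pred_prod _ _ HB HB) (finite_pred_prod _ _ Hd Hd))).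
  - intros [a s b a' b' d d'] H. exists ((a, s, b), (a', b', (d, d'))). split; auto. simpl.
    unfold fwd, rew in H.
    assert (Hs : forall k g, sym k g -> k <= B).
    { intros k g (j & -> & Hj). apply nth_error_lt in Hj. unfold B. lia. }
    assert (Hw : forall k o, wsym k o -> k <= B).
    { intros k [g|]; simpl; eauto. lia. }
    inversion H; subst;
      repeat match goal with
      | H : nth_error lQ _ = _ |- _ => apply nth_error_lt in H
      | H : sym _ _ |- _ => apply Hs in H
      | H : wsym _ _ |- _ => apply Hw in H end;
      unfold fwd, rew in *; repeat split; auto; unfold B in *; lia.
Qed.

(** A sweep that appends nothing still writes a 0 behind the word, so the list may end in one
    explicit blank; the next sweep overwrites that cell. *)
Definition blanks (zs : list nat) : Prop := zs = [] \/ zs = [0].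

Definition dec (cu : list nat) (u : list G) : Prop := Forall2 sym cu u.

Lemma write_w_app w1 w2 s : write_w (w1 ++ w2) (length w1) s = w1 ++ write_w w2 0 s.
Proof. induction w1; simpl; auto. now f_equal. Qed.

Lemma dec_length cu u : dec cu u -> length cu = length u.
Proof. apply Forall2_length. Qed.

Lemma sym_fun k a b : sym k a -> sym k b -> a = b.
Proof.
  intros (j & -> & H) (j' & E & H'). assert (j' = j) by lia. subst. congruence.
Qed.

Lemma sym_big k a : sym k a -> 2 <= k.
Proof. intros (j & -> & _). lia. Qed.

Lemma write_blank zs s : blanks zs -> write_w zs 0 s = [s].
Proof. intros [->| ->]; reflexivity. Qed.

Lemma nth_blank zs : blanks zs -> nth 0 zs 0 = 0.
Proof. intros [->| ->]; reflexivity. Qed.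

(** Every configuration is tied to the last completed sweep. During a sweep the invariant remembers
    [u1], the part already overwritten by [v1], so that the whole [run] can be assembled at the
    right end. *)
Inductive tm_inv (x : list bool) : config -> Prop :=
| inv_start : tm_inv x (mkConfig 0 0 [] 0)
| inv_fwd q i u1 u2 v1 r k c1 c2 zs :
    sreach x (q, i, u1 ++ u2) -> run q u1 v1 r -> nth_error lQ k = Some r ->
    dec c1 v1 -> dec c2 u2 -> blanks zs ->
    tm_inv x (mkConfig (fwd k) i ((1 :: c1) ++ c2 ++ zs) (length (1 :: c1)))
| inv_rew q i u k c zs h :
    sreach x (q, i, u) -> nth_error lQ k = Some q -> dec c u -> blanks zs -> h <= length u ->
    tm_inv x (mkConfig (rew k) i (1 :: c ++ zs) h).

Lemma move_in_stay n i : move_in n i DStay = i.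
Proof. reflexivity. Qed.

Lemma write_w_same c zs h : h < length c -> write_w (c ++ zs) h (nth h (c ++ zs) 0) = c ++ zs.
Proof.
  revert h; induction c as [|a c IH]; simpl; intros h H; [lia|].
  destruct h; simpl; auto. f_equal. apply IH. lia.
Qed.

Lemma tm_inv_step M x c c' :
  start M = 0 -> (forall t, In t (delta M) -> trans_ok t) ->
  tm_inv x c -> step M x c c' -> tm_inv x c'.
Proof.
  intros HM HT Hc (t & Ht & Hq & Hs & Hw & ->). apply HT in Ht. clear HT HM M.
  inversion Hc; subst c; simpl in *.
  - inversion Ht; subst t; unfold fwd, rew in *; simpl in *; subst; try lia.
    change (k + (k + 0) + 2) with (rew k).
    change [1] with (1 :: [] ++ []).
    apply inv_rew with q0 []; auto; [apply rt_refl|constructor|left; auto].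
  - rename c1 into cv, c2 into cu.
    change (1 :: cv ++ cu ++ zs) with ((1 :: cv) ++ cu ++ zs) in *.
    change (S (length cv)) with (length (1 :: cv)) in *.
    assert (HW : nth (length (1 :: cv)) ((1 :: cv) ++ cu ++ zs) 0 = nth 0 (cu ++ zs) 0).
    { rewrite app_nth2, Nat.sub_diag; auto. }
    simpl length in HW. simpl in HW. 
    (* Parity of the state number excludes the start and rewinding transitions. *)
    inversion Ht; subst t; unfold fwd, rew in *; simpl in *; subst; try lia;
      try (assert (k0 = k) by lia; subst k0).
    + rewrite HW in *. replace q1 with r in * by congruence.
      destruct cu as [|cj cu]; simpl in *.
      { rewrite nth_blank in * by auto. apply sym_big in H6. lia. }
      inversion H3; subst.
      pose proof (sym_fun _ _ _ H6 H12); subst y.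
      pose proof (write_w_app (1 :: cv) (cj :: cu ++ zs) j') as E.
      simpl in E. rewrite E.
      change (k' + (k' + 0) + 1) with (fwd k').
      replace (1 :: cv ++ j' :: cu ++ zs) with ((1 :: (cv ++ [j'])) ++ cu ++ zs)
        by (simpl; rewrite <- app_assoc; reflexivity).
      replace (S (S (length cv))) with (length (1 :: (cv ++ [j'])))
        by (simpl; rewrite length_app; simpl; lia).
      apply inv_fwd with q (u1 ++ [a]) l' (v1 ++ [b]) q'; auto.
      * rewrite <- app_assoc. exact H.
      * eapply run_app; eauto. econstructor; eauto. constructor.
      * apply Forall2_app; auto.
    + rewrite HW in *. replace q1 with r in * by congruence.
      destruct cu as [|cj cu]; simpl in *.
      2:{ inversion H3; subst. apply sym_big in H11. lia. }
      inversion H3; subst. rewrite app_nil_r in *.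
      pose proof (write_w_app (1 :: cv) zs w) as E.
      rewrite write_blank in E by auto. simpl in E. rewrite E.
      change (k' + (k' + 0) + 2) with (rew k').
      pose proof (dec_length _ _ H2) as L1. pose proof (run_length _ _ _ _ H0) as L2.
      assert (HS : sreach x (q', move_in (length x) i d, v1 ++ optl o)).
      { eapply rt_trans; [exact H|]. apply rt_step. econstructor; eauto. }
      destruct o as [g|]; simpl in *.
      * replace (1 :: cv ++ [w]) with (1 :: (cv ++ [w]) ++ []) by (now rewrite app_nil_r).
        eapply inv_rew; eauto.
        -- apply Forall2_app; auto.
        -- left; auto.
        -- rewrite length_app; simpl; lia.
      * subst w. rewrite app_nil_r in HS.
        eapply inv_rew; eauto.
        -- right; auto.
        -- lia.
  - rename c0 into cu.
    inversion Ht; subst t; unfold fwd, rew in *; simpl in *; subst; try lia;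
      try (assert (k0 = k) by lia; subst k0).
    + pose proof (sym_big _ _ H5) as Hb.
      destruct h as [|h]; [lia|].
      assert (E : write_w (cu ++ zs) h (nth h (cu ++ zs) 0) = cu ++ zs).
      { apply write_w_same. apply dec_length in H1. lia. }
      simpl. rewrite E. change (k + (k + 0) + 2) with (rew k).
      eapply inv_rew; eauto. lia.
    (* The symbol 1 occurs only in cell 0, because letters are coded from 2 on. *)
    + assert (h = 0) as ->.
      { destruct h as [|h]; auto. exfalso. apply dec_length in H1 as L.
        assert (Hx : exists a, sym (nth h (cu ++ zs) 0) a).
        { rewrite app_nth1 by lia. clear - H1 H3 L. revert h u H1 H3 L.
          induction cu as [|y cu IH]; intros h u H1 H3 L; inversion H1; subst; simpl in *; [lia|].
          destruct h; eauto. eapply IH; eauto; lia. }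
        destruct Hx as [a Ha]. apply sym_big in Ha. lia. }
      change (k + (k + 0) + 1) with (fwd k). 
      change (1 :: cu ++ zs) with ((1 :: []) ++ cu ++ zs).
      exact (inv_fwd x q i [] u [] q k [] cu zs H (run_nil q) H0 (Forall2_nil _) H1 H2).
Qed.

Lemma tm_inv_reachable M x c :
  start M = 0 -> (forall t, In t (delta M) -> trans_ok t) ->
  reachable M x c -> tm_inv x c.
Proof.
  intros HM HT H. apply clos_rt_rtn1 in H. induction H as [|c c' H _ IH].
  - unfold init_config. rewrite HM. constructor.
  - eapply tm_inv_step; eauto.
Qed.

(** The two extra cells are the left marker and the blank read at the right end. *)
Lemma tm_inv_space x c :
  tm_inv x c -> exists q i u, sreach x (q, i, u) /\ space c <= length u + 2.
Proof.
  intros H. inversion H; subst.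
  - exists q0, 0, []. split; [apply rt_refl|]. unfold space; simpl. lia.
  - exists q, i, (u1 ++ u2). split; auto. unfold space. simpl.
    apply run_length in H1. apply dec_length in H3. apply dec_length in H4.
    rewrite !length_app. destruct H5 as [->| ->]; simpl; lia.
  - exists q, i, u. split; auto. unfold space. simpl.
    apply dec_length in H2. rewrite length_app. destruct H3 as [->| ->]; simpl; lia.
Qed.

Lemma sreach_in x q i u :
  sreach x (q, i, u) -> In q lQ /\ (forall a, In a u -> In a lG).
Proof.
  intros H. apply clos_rt_rtn1 in H. remember (q, i, u) as c eqn:E.
  revert q i u E. induction H as [|c c' H _ IH]; intros q i u E.
  - injection E as <- <- <-. simpl; tauto.
  - subst c'. inversion H as [q1 i1 u1 v r o d q' Hrun Hend E1 E2]; subst.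
    destruct (IH _ _ _ eq_refl) as [Hin1 Hin2].
    destruct (mend_fin _ _ _ _ _ Hend) as [Hin3 Hin4]. split; auto.
    intros a. rewrite in_app_iff. intros [Ha|Ha].
    + clear - mst_fin Hrun Ha. induction Hrun; simpl in *; [tauto|].
      destruct Ha as [<-|Ha]; auto. eapply mst_fin; eauto.
    + destruct o; simpl in Ha; [|tauto]. destruct Ha as [<-|[]]; auto.
Qed.

Section Complete.

Variables (M : ntm) (x : list bool).
Hypothesis M_start : start M = 0.
Hypothesis M_delta : forall t, trans_ok t -> In t (delta M).

Lemma step_of t c c' :
  trans_ok t -> tq t = cq c -> tin t = input_sym x (ci c) -> tw t = nth (ch c) (cw c) 0 ->
  c' = mkConfig (tq' t) (move_in (length x) (ci c) (tim t))
                  (write_w (cw c) (ch c) (twr t)) (move_w (ch c) (twm t)) ->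
  clos_refl_trans _ (step M x) c c'.
Proof. intros. apply rt_step. exists t. auto 10. Qed.

Lemma dec_nth cu u zs h :
  dec cu u -> h < length u -> exists a, sym (nth h (cu ++ zs) 0) a.
Proof.
  intros H. revert h. induction H as [|k a cu u Ha H IH]; simpl; intros h L; [lia|].
  destruct h; eauto. apply IH. lia.
Qed.

Lemma tm_rewind k q i u cu zs h :
  nth_error lQ k = Some q -> dec cu u -> blanks zs -> h <= length u ->
  clos_refl_trans _ (step M x) (mkConfig (rew k) i (1 :: cu ++ zs) h)
                               (mkConfig (rew k) i (1 :: cu ++ zs) 0).
Proof.
  intros Hk Hu Hz. induction h as [|h IH]; intros L; [apply rt_refl|].
  eapply rt_trans; [|apply IH; lia].
  destruct (dec_nth cu u zs h Hu) as [a Ha]; [lia|].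
  eapply step_of with (t := mkTrans (rew k) (input_sym x i) _ (rew k) _ DStay DLeft);
    [eapply T_rew; eauto|reflexivity..|].
  simpl. f_equal. f_equal. symmetry. apply write_w_same.
  apply dec_length in Hu. lia.
Qed.

Lemma tm_run q u v r : run q u v r -> forall k i cv cu zs,
  nth_error lQ k = Some q -> dec cu u -> blanks zs ->
  exists k' cv', nth_error lQ k' = Some r /\ dec cv' v /\
  clos_refl_trans _ (step M x)
    (mkConfig (fwd k) i ((1 :: cv) ++ cu ++ zs) (length (1 :: cv)))
    (mkConfig (fwd k') i ((1 :: cv ++ cv') ++ zs) (length (1 :: cv ++ cv'))).
Proof.
  induction 1 as [q|q a b q' u v q'' Hm Hr IH]; intros k i cv cu zs Hk Hu Hz.
  - inversion Hu; subst. exists k, []. split; [auto|split; [constructor|]].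
    rewrite app_nil_r. apply rt_refl.
  - inversion Hu as [|j a' cu' u' Hj Hu' E1 E2]; subst.
    destruct (mst_fin _ _ _ _ Hm) as [Hb Hq'].
    destruct (In_nth_error _ _ Hq') as [k1 Hk1].
    destruct (In_nth_error _ _ Hb) as [jb Hjb].
    destruct (IH k1 i (cv ++ [jb + 2]) cu' zs Hk1 Hu' Hz) as (k' & cv' & Hk' & Hv & Hstep).
    exists k', (jb + 2 :: cv'). split; auto. split.
    { constructor; auto. exists jb; auto. }
    rewrite <- app_assoc in Hstep. simpl app in Hstep at 3 4.
    eapply rt_trans; [|exact Hstep].
    eapply step_of with (t := mkTrans (fwd k) (input_sym x i) j (fwd k1) (jb + 2) DStay DRight).
    + eapply T_fwd; eauto. exists jb; auto.
    + reflexivity.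
    + reflexivity.
    + cbn [ch cw tw]. rewrite app_nth2, Nat.sub_diag; auto.
    + cbn [ch cw ci tq' twr tim twm]. rewrite write_w_app. rewrite move_in_stay. f_equal.
      * simpl. rewrite <- app_assoc. reflexivity.
      * simpl. rewrite length_app. simpl. lia.
Qed.

(** All indices [k] of [q] are covered because [lQ] may list a state more than once, and acceptance
    fixes one index. *)
Lemma tm_complete q i u :
  sreach x (q, i, u) -> forall k, nth_error lQ k = Some q ->
  exists cu zs h, dec cu u /\ blanks zs /\ h <= length u /\
    reachable M x (mkConfig (rew k) i (1 :: cu ++ zs) h).
Proof.
  intros H. apply clos_rt_rtn1 in H. remember (q, i, u) as c eqn:E.
  revert q i u E. induction H as [|c c' H Hpre IH]; intros q i u E k Hk.
  - injection E as <- <- <-. exists [], [], 0.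
    split; [constructor|split; [left; auto|split; [auto|]]].
    unfold reachable, init_config. rewrite M_start.
    eapply step_of; [eapply T_start; eauto| reflexivity..].
  - subst c'. inversion H as [q1 i1 u1 v r o d q' Hrun Hend E1 E2]; subst.
    destruct (In_nth_error lQ q1) as [k1 Hk1].
    { apply (sreach_in x q1 i1 u1). apply clos_rtn1_rt. exact Hpre. }
    destruct (IH _ _ _ eq_refl k1 Hk1) as (cu & zs & h & Hu & Hz & Hh & Hreach).
    destruct (tm_run _ _ _ _ Hrun k1 i1 [] cu zs Hk1 Hu Hz) as (k2 & cv & Hk2 & Hv & Hsteps).
    assert (Hw : exists w, wsym w o).
    { destruct o as [g|]; simpl; [|eauto].
      destruct (mend_fin _ _ _ _ _ Hend) as [Hg _].
      destruct (In_nth_error lG g) as [j Hj]; auto. exists (j + 2), j. auto. }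
    destruct Hw as [w Hw].
    assert (Hlast : clos_refl_trans _ (step M x)
      (mkConfig (fwd k2) i1 ((1 :: cv) ++ zs) (length (1 :: cv)))
      (mkConfig (rew k) (move_in (length x) i1 d) ((1 :: cv) ++ [w]) (length cv))).
    { eapply step_of with (t := mkTrans (fwd k2) (input_sym x i1) 0 (rew k) w d DLeft).
      - eapply T_end; eauto.
      - reflexivity.
      - reflexivity.
      - cbn [ch cw tw]. rewrite app_nth2, Nat.sub_diag, nth_blank; auto.
      - cbn [ch cw ci tq' twr tim twm]. rewrite write_w_app, write_blank by auto. reflexivity. }
    assert (Hall : reachable M x
      (mkConfig (rew k) (move_in (length x) i1 d) ((1 :: cv) ++ [w]) (length cv))).
    { eapply rt_trans; [exact Hreach|].
      eapply rt_trans; [eapply tm_rewind; eauto|].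
      eapply rt_trans; [|exact Hlast].
      eapply rt_trans; [|exact Hsteps].
      eapply step_of with (t := mkTrans (rew k1) (input_sym x i1) 1 (fwd k1) 1 DStay DRight);
        [eapply T_turn; eauto|reflexivity..]. }
    pose proof (dec_length _ _ Hv) as Lv.
    destruct o as [g|]; simpl in *.
    + exists (cv ++ [w]), [], (length cv). repeat split.
      * apply Forall2_app; auto. 
      * left; auto.
      * rewrite length_app. simpl. lia.
      * rewrite app_nil_r. exact Hall.
    + subst w. exists cv, [0], (length cv). rewrite app_nil_r. repeat split; auto; [right; auto|lia].
Qed.

End Complete.

Theorem sweep_ntm : exists M : ntm, forall x,
  (forall c, reachable M x c ->
     exists q i u, sreach x (q, i, u) /\ space c <= length u + 2) /\
  ((exists c, reachable M x c /\ cq c = accept M) <->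
   exists i u, sreach x (qacc, i, u)).
Proof.
  destruct (finite_pred_exact _ trans_ok_finite) as [D HD].
  destruct (In_nth_error _ _ qacc_in) as [ka Hka].
  exists (mkNTM 0 (rew ka) D). intros x. split; [|split].
  - intros c Hc. apply tm_inv_space. eapply tm_inv_reachable; eauto; auto.
    intros t Ht. apply HD. exact Ht.
  - intros (c & Hc & Ha). eapply tm_inv_reachable in Hc; auto.
    2:{ intros t Ht. apply HD. exact Ht. }
    simpl in Ha. inversion Hc; subst c; unfold rew, fwd in Ha; simpl in Ha; try lia.
    assert (k = ka) by lia. subst k. exists i, u. congruence.
  - intros (i & u & H).
    destruct (tm_complete (mkNTM 0 (rew ka) D) x eq_refl (fun t => proj2 (HD t)) _ _ _ H ka Hka)
      as (cu & zs & h & _ & _ & _ & Hr).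
    eexists; split; [exact Hr|reflexivity].
Qed.

End Sweep.

(** * A proof-search machine for derivations *)

Inductive sval : Type := SB (b : bool) | SP (i : nat).

Definition dval (x : list bool) (s : sval) : val :=
  match s with SB b => VB b | SP i => VL (skipn i x) end.

(** Every position beyond the end denotes the empty list; the bound makes the code of a value
    unique, so equality of values is equality of registers. *)
Definition gsval (x : list bool) (s : sval) : Prop :=
  match s with SB _ => True | SP i => i <= length x end.

(* The obligation [mkObl sg m e k]: the expression [e] of a function of arity [m] evaluates to register [k], in the environment held by the first register bank ([sg = false]) or the second one. *)
Record obl : Type := mkObl { osig : bool; oar : nat; oex : expr; otgt : nat }.

(** [Prove] is a goal whose last rule is not chosen yet, [Pend] holds the premises left after that
    choice, and [Bot] marks the bottom of the stack. *)
Inductive ctl : Type :=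
| Prove (m : nat) (e : expr)
| Pend (Os : list obl)
| Bot.

Definition frame : Type := (ctl * (nat -> sval))%type.

(** Only comparisons that a finite transducer can make digit by digit, with the input head position
    [h] as reference; [CSucc] needs a carry. *)
Inductive check : Type :=
| CConst (k : nat) (b : bool)
| CEq (k l : nat)
| CHere (k : nat)
| CSucc (k : nat).

Inductive sympat : Type := SAny | SEnd | SMore | SBit (b : bool).

Definition sympat_ok (sp : sympat) (s : option bool) : Prop :=
  match sp with
  | SAny => True
  | SEnd => s = None
  | SMore => s <> None
  | SBit b => s = Some b
  end.

(** Stepping right and returning to 0 reach every position, so the position register has to be
    incremented and cleared but never decremented. *)
Inductive op : Type :=
| ORight
| OZero
| OGuess (m : nat) (e : expr) (j : nat) (src : option bool)
| OExp (m : nat) (e : expr) (cks : list check) (sp : sympat) (Os : list obl)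
| OPush (O1 : list obl) (o : obl) (O2 : list obl)
| OTail (o : obl)
| OPop
| OAcc.

(** Polymorphic so that one description of a stack operation applies both to frames and to the
    slices of frames stored in a column. *)
Inductive act (A : Type) : Type := AKeep (f : A) | APush (f g : A) | APop.
Arguments AKeep {A}. Arguments APush {A}. Arguments APop {A}.

Definition act_map {A B : Type} (g : A -> B) (a : act A) : act B :=
  match a with AKeep f => AKeep (g f) | APush f f' => APush (g f) (g f') | APop => APop end.

Definition act_app {A : Type} (a : act A) (st : list A) : list A :=
  match a with AKeep f => f :: st | APush f g => f :: g :: st | APop => st end.

Definition upd {A : Type} (r : nat -> A) (k : nat) (s : A) : nat -> A :=
  fun l => if l =? k then s else r l.

#[local] Arguments Nat.mul : simpl never.

Section Machine.

(* Register layout: current environment in [0 .. M-1], guessed intermediate values (the scratch bank) in [M .. 2M-1], expected result in [2M]. *)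
Variables (p : program) (M : nat) (L : list (nat * expr)).

Definition argobls (m : nat) : nat -> list expr -> list obl :=
  fix args k es := match es with
    | [] => []
    | e :: es => mkObl false m e k :: args (S k) es
    end.

(** Guessed values already sit in the scratch bank, so a rule is a test of registers and input
    symbol plus a list of premises. For a call the scratch bank receives the argument values and is
    then the environment of the body. The empty list is the position at which the head reads the end
    marker. *)
Definition rules (m : nat) (e : expr) : list (list check * sympat * list obl) :=
  let V := 2 * M in
  match e with
  | ETrue => [([CConst V true], SAny, [])]
  | EFalse => [([CConst V false], SAny, [])]
  | ENil => [([CHere V], SEnd, [])]
  | EVar i => if i <? m then [([CEq V i], SAny, [])] else []
  | ENot e => map (fun b => ([CConst V (negb b); CConst M b], SAny, [mkObl false m e M]))
                  [true; false]
  | ENull e => [([CConst V true; CHere M], SEnd, [mkObl false m e M]);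
                ([CConst V false; CHere M], SMore, [mkObl false m e M])]
  | EHead e => map (fun b => ([CConst V b; CHere M], SBit b, [mkObl false m e M]))
                   [true; false]
  | ETail e => [([CSucc V; CHere M], SMore, [mkObl false m e M])]
  | EIf e0 e1 e2 =>
      [([CConst M true], SAny, [mkObl false m e0 M; mkObl false m e1 V]);
       ([CConst M false], SAny, [mkObl false m e0 M; mkObl false m e2 V])]
  | ECall f es =>
      match nth_error p f with
      | Some (m', body) =>
          if length es =? m'
          then [([], SAny, argobls m M es ++ [mkObl true m' body V])] else []
      | None => []
      end
  end.

Definition obl_ok (o : obl) : Prop := In (oar o, oex o) L /\ otgt o <= 2 * M.
(** A call has at most [M] arguments and one body; the bound keeps the set of control parts
    finite. *)
Definition obls_ok (Os : list obl) : Prop := length Os <= M + 1 /\ Forall obl_ok Os.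

Hypothesis M_pos : 1 <= M.
Hypothesis L_arity : forall m e, In (m, e) L -> m <= M.
Hypothesis L_closed : forall m e cks sp Os,
  In (m, e) L -> In (cks, sp, Os) (rules m e) -> obls_ok Os.

Definition op_ok (o : op) : Prop :=
  match o with
  | ORight | OZero | OPop | OAcc => True
  | OGuess m e j _ => In (m, e) L /\ j < M
  | OExp m e cks sp Os => In (m, e) L /\ In (cks, sp, Os) (rules m e)
  | OPush O1 o O2 => obls_ok (O1 ++ o :: O2)
  | OTail o => obls_ok [o]
  end.

Definition check_holds (h : nat) (r : nat -> sval) (c : check) : Prop :=
  match c with
  | CConst k b => r k = SB b
  | CEq k l => r k = r l
  | CHere k => r k = SP h
  | CSucc k => r k = SP (S h)
  end.

Definition op_pre (o : op) (h : nat) (f : frame) : Prop :=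
  match o with
  | ORight | OZero => True
  | OGuess m e _ _ => fst f = Prove m e
  | OExp m e cks _ _ => fst f = Prove m e /\ Forall (check_holds h (snd f)) cks
  | OPush O1 o O2 => fst f = Pend (O1 ++ o :: O2)
  | OTail o => fst f = Pend [o]
  | OPop => fst f = Pend []
  | OAcc => fst f = Bot
  end.

(** Entering a premise merely renames registers, hence it acts on each digit column separately. *)
Definition reg_of (o : obl) (k : nat) : nat :=
  if k <? M then if osig o then M + k else k
  else if k =? 2 * M then otgt o else k.

Definition enter (o : obl) (r : nat -> sval) : frame :=
  (Prove (oar o) (oex o), fun k => r (reg_of o k)).

Definition op_act (o : op) (h : nat) (f : frame) : act frame :=
  match o with
  | ORight | OZero | OAcc => AKeep f
  | OGuess _ _ j src =>
      AKeep (fst f, upd (snd f) (M + j) (match src with Some b => SB b | None => SP h end))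
  | OExp _ _ _ _ Os => AKeep (Pend Os, snd f)
  | OPush O1 o O2 => APush (enter o (snd f)) (Pend (O1 ++ O2), snd f)
  | OTail o => AKeep (enter o (snd f))
  | OPop => APop
  end.

Definition op_pos (o : op) (h : nat) : nat :=
  match o with ORight => S h | OZero => 0 | _ => h end.

Definition op_sym (o : op) (s : option bool) : Prop :=
  match o with
  | ORight => s <> None
  | OExp _ _ _ sp _ => sympat_ok sp s
  | _ => True
  end.

Definition mconf : Type := (nat * list frame)%type.

Inductive mstep (x : list bool) : mconf -> mconf -> Prop :=
| mstep_op o h f st :
    op_ok o -> op_pre o h f -> op_sym o (nth_error x h) ->
    mstep x (h, f :: st) (op_pos o h, act_app (op_act o h f) st).

Definition env (x : list bool) (r : nat -> sval) (s m : nat) : list val :=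
  map (fun k => dval x (r k)) (seq s m).

Definition obl_env (x : list bool) (r : nat -> sval) (o : obl) : list val :=
  env x r (if osig o then M else 0) (oar o).

Definition obl_holds (x : list bool) (r : nat -> sval) (o : obl) (t : nat) : Prop :=
  eval p (obl_env x r o) (oex o) (dval x (r (otgt o))) t.

Definition frame_holds (x : list bool) (f : frame) : Prop :=
  match fst f with
  | Prove m e => exists t, eval p (env x (snd f) 0 m) e (dval x (snd f (2 * M))) t
  | Pend Os => Forall (fun o => exists t, obl_holds x (snd f) o t) Os
  | Bot => True
  end.

#[local] Arguments frame_holds : simpl never.

Lemma env_ext x r r' s s' m :
  (forall k, k < m -> r (s + k) = r' (s' + k)) -> env x r s m = env x r' s' m.
Proof.
  unfold env. revert s s'. induction m as [|m IH]; intros s s' H; simpl; auto.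
  f_equal.
  - specialize (H 0). rewrite !Nat.add_0_r in H. rewrite H; auto. lia.
  - apply IH. intros k Hk. specialize (H (S k)).
    rewrite <- !plus_n_Sm in H. apply H. lia.
Qed.

Lemma enter_holds x o r :
  oar o <= M ->
  forall t, obl_holds x r o t <->
  eval p (env x (snd (enter o r)) 0 (oar o)) (oex o) (dval x (snd (enter o r) (2 * M))) t.
Proof.
  intros Ho t. unfold obl_holds, obl_env, enter. cbn [snd].
  replace (reg_of o (2 * M)) with (otgt o).
  2:{ unfold reg_of. destruct (Nat.ltb_spec (2 * M) M); [lia|].
      now rewrite Nat.eqb_refl. }
  replace (env x (fun k => r (reg_of o k)) 0 (oar o))
    with (env x r (if osig o then M else 0) (oar o)); [tauto|].
  apply env_ext. intros k Hk. unfold reg_of. simpl.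
  destruct (Nat.ltb_spec k M); [|lia]. destruct (osig o); auto.
Qed.

Lemma skipn_nth_error {A : Type} (l : list A) i a :
  nth_error l i = Some a -> skipn i l = a :: skipn (S i) l.
Proof.
  revert i; induction l as [|b l IH]; intros [|i] H; simpl in *; try congruence.
  rewrite (IH i H). destruct l; reflexivity.
Qed.

Lemma nth_error_env x r s m i : i < m -> nth_error (env x r s m) i = Some (dval x (r (s + i))).
Proof.
  intros H. unfold env. rewrite nth_error_map, nth_error_seq.
  destruct (Nat.ltb_spec i m); [reflexivity|lia].
Qed.

Lemma argobls_evals x r m k es :
  Forall (fun o => exists t, obl_holds x r o t) (argobls m k es) ->
  exists ts, evals p (env x r 0 m) es (env x r k (length es)) ts.
Proof.
  revert k. induction es as [|e es IH]; intros k H; simpl in *.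
  - exists 0. constructor.
  - inversion H; subst. destruct H2 as [t Ht]. destruct (IH _ H3) as [ts Hts].
    exists (t + ts). constructor; auto.
Qed.

Lemma rules_sound x h r m e cks sp Os :
  In (cks, sp, Os) (rules m e) -> Forall (check_holds h r) cks ->
  sympat_ok sp (nth_error x h) ->
  Forall (fun o => exists t, obl_holds x r o t) Os ->
  exists t, eval p (env x r 0 m) e (dval x (r (2 * M))) t.
Proof.
  intros HR HC HS HO.
  assert (Hsp : forall b, nth_error x h = Some b -> skipn h x = b :: skipn (S h) x)
    by (intros; now apply skipn_nth_error).
  assert (Hse : nth_error x h = None -> skipn h x = []).
  { intros H. apply skipn_all2. now apply nth_error_None. }
  unfold rules in HR. cbv zeta in HR. remember (2 * M) as V eqn:EV. clear EV.
  destruct e; cbn [map In] in HR.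
  all: repeat match type of HR with _ \/ _ => destruct HR as [HR|HR] end; try tauto.
  4:{ destruct (Nat.ltb_spec n m); [|destruct HR]. destruct HR as [HR|[]].
      injection HR as <- <- <-. inversion HC; subst. cbn [check_holds] in H2. rewrite H2.
      eexists. apply ev_var. now rewrite nth_error_env. }
  13:{ destruct (nth_error p n) as [[m' body]|] eqn:E; [|destruct HR].
       destruct (Nat.eqb_spec (length l) m'); [|destruct HR]. destruct HR as [HR|[]].
       injection HR as <- <- <-. apply Forall_app in HO. destruct HO as [Ha Hb].
       inversion Hb; subst. destruct H1 as [t Ht].
       destruct (argobls_evals _ _ _ _ _ Ha) as [ts Hts].
       eexists. eapply ev_call; eauto. }
  all: injection HR as <- <- <-;
    repeat match goal with
    | H : Forall _ (_ :: _) |- _ => inversion H; subst; clear H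
    | H : Forall _ [] |- _ => clear H
    | H : exists t, obl_holds _ _ _ t |- _ => destruct H as [? ?] end;
    unfold obl_holds, obl_env in *; cbn [check_holds sympat_ok osig oar oex otgt] in *;
    repeat match goal with H : @eq sval _ _ |- _ => rewrite H in *; clear H end; cbn [dval] in *.
  all: try (rewrite (Hse HS) in *).
  all: try (destruct (nth_error x h) as [b'|] eqn:E; [|congruence]; rewrite (Hsp _ eq_refl) in *).
  all: try solve [eexists; econstructor; eauto].
  all: try solve [eexists; eapply ev_if_false; eauto].
  1: exists (S x0); exact (ev_not p _ _ true _ H).
  1: exists (S x0); exact (ev_not p _ _ false _ H).
  all: injection HS as ->; eexists; econstructor; eauto.
Qed.

(** Truth travels backwards: the frames put on the stack imply the frame they replace. A guess
    changes only scratch registers, which neither the environment nor the result of a [Prove] frame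
    reads, and a popped frame has no premise left. *)
Lemma mstep_sound x c c' :
  mstep x c c' -> Forall (frame_holds x) (snd c') -> Forall (frame_holds x) (snd c).
Proof.
  intros H. inversion H as [o h [f r] st Hok Hpre Hsym]; subst; clear H. simpl snd.
  destruct o; simpl in *; intros HF; auto.
  - destruct Hok as [HL Hj]. apply L_arity in HL. subst f.
    inversion HF; subst. constructor; auto. unfold frame_holds in *; simpl fst in *; simpl snd in *.
    destruct H1 as [t Ht]. exists t.
    unfold upd in Ht at 2. destruct (Nat.eqb_spec (2 * M) (M + j)); [lia|].
    erewrite env_ext; [exact Ht|]. intros k Hk. unfold upd. simpl.
    destruct (Nat.eqb_spec k (M + j)); [lia|auto].
  - destruct Hok as [HL Hr]. destruct Hpre as [-> Hc]. inversion HF; subst.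
    constructor; auto. eapply rules_sound; eauto.
  - inversion HF; subst. inversion H2; subst. constructor; auto.
    unfold frame_holds in *; simpl fst in *; simpl snd in *.
    destruct Hok as [_ Hok]. apply Forall_elt in Hok. destruct Hok as [Hok _].
    apply L_arity in Hok. destruct H1 as [t Ht].
    apply Forall_app in H3. destruct H3. apply Forall_app; split; auto. constructor; auto.
    exists t. apply enter_holds; auto.
  - inversion HF; subst. constructor; auto.
    unfold frame_holds in *; simpl fst in *; simpl snd in *.
    destruct Hok as [_ Hok]. inversion Hok; subst. destruct H3 as [H3 _].
    apply L_arity in H3. destruct H1 as [t Ht]. constructor; auto.
    exists t. apply enter_holds; auto.
  - constructor; auto. subst f. constructor.
Qed.

(** Ensures that a [Bot] frame on top is the whole stack, so that all goals have been discharged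
    when [OAcc] applies. *)
Definition bottomed (st : list frame) : Prop :=
  exists fs b, st = fs ++ [b] /\ fst b = Bot /\ Forall (fun f => fst f <> Bot) fs.

Lemma bottomed_cons f st : fst f <> Bot -> bottomed st -> bottomed (f :: st).
Proof.
  intros Hf (fs & b & -> & Hb & HF). exists (f :: fs), b. repeat split; auto.
Qed.

Lemma bottomed_tail f st : fst f <> Bot -> bottomed (f :: st) -> bottomed st.
Proof.
  intros Hf (fs & b & E & Hb & HF). destruct fs as [|g fs]; simpl in E; injection E as -> ->.
  - tauto.
  - inversion HF; subst. exists fs, b. auto.
Qed.

Lemma bottomed_bot f st : fst f = Bot -> bottomed (f :: st) -> st = [].
Proof.
  intros Hf (fs & b & E & Hb & HF). destruct fs as [|g fs]; simpl in E; injection E as -> ->; auto.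
  inversion HF; subst. tauto.
Qed.

Lemma mstep_bottomed x c c' : mstep x c c' -> bottomed (snd c) -> bottomed (snd c').
Proof.
  intros H. inversion H as [o h [f r] st Hok Hpre Hsym]; subst; clear H. simpl snd.
  destruct o; simpl in *; intros HF; auto;
    try (match type of Hpre with _ /\ _ => destruct Hpre as [Hpre _] end); try subst f;
    try (apply bottomed_tail in HF; [|discriminate]); auto;
    repeat (apply bottomed_cons; [discriminate|]); auto.
Qed.

Lemma msteps_sound x c f h st :
  clos_refl_trans _ (mstep x) c (h, f :: st) -> bottomed (snd c) -> fst f = Bot ->
  Forall (frame_holds x) (snd c).
Proof.
  intros H. apply clos_rt_rt1n in H. remember (h, f :: st) as c' eqn:E.
  induction H as [|c c1 c' Hs _ IH]; intros Hb Hf; subst.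
  - simpl in *. rewrite (bottomed_bot _ _ Hf Hb). constructor; auto.
    unfold frame_holds. now rewrite Hf.
  - eapply mstep_sound; eauto. apply IH; auto. eapply mstep_bottomed; eauto.
Qed.

(** * Completeness with logarithmically bounded stacks *)

Definition gsregs (x : list bool) (r : nat -> sval) : Prop := forall k, gsval x (r k).

Scheme eval_mut := Minimality for eval Sort Prop
  with evals_mut := Minimality for evals Sort Prop.
Combined Scheme eval_evals_ind from eval_mut, evals_mut.

Definition is_suffix_val (x : list bool) (v : val) : Prop :=
  exists s, gsval x s /\ dval x s = v.

Lemma eval_suffix x :
  (forall rho e v t, eval p rho e v t ->
     Forall (is_suffix_val x) rho -> is_suffix_val x v) /\
  (forall rho es vs t, evals p rho es vs t ->
     Forall (is_suffix_val x) rho -> Forall (is_suffix_val x) vs).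
Proof.
  assert (HB : forall b, is_suffix_val x (VB b)) by (intros b; exists (SB b); simpl; auto).
  apply eval_evals_ind; intros; auto.
  - exists (SP (length x)). simpl. split; [lia|]. now rewrite skipn_all.
  - rewrite Forall_forall in H0. apply H0. eapply nth_error_In; eauto.
  - destruct (H0 H1) as [[b'|i] [Hi E]]; simpl in *; [discriminate|].
    injection E as E. exists (SP (S i)).
    assert (i < length x).
    { destruct (Nat.lt_ge_cases i (length x)); auto. rewrite skipn_all2 in E by lia. discriminate. }
    simpl. split; [lia|]. f_equal.
    destruct (nth_error x i) as [c|] eqn:Ex.
    + rewrite (skipn_nth_error _ _ _ Ex) in E. now injection E.
    + apply nth_error_None in Ex. lia.
Qed.

Lemma gsregs_env x r s m : gsregs x r -> Forall (is_suffix_val x) (env x r s m).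
Proof.
  intros H. apply Forall_forall. intros v Hv. unfold env in Hv.
  apply in_map_iff in Hv. destruct Hv as (k & <- & _). exists (r k). auto.
Qed.

Lemma dval_inj x s s' : gsval x s -> gsval x s' -> dval x s = dval x s' -> s = s'.
Proof.
  destruct s as [b|i], s' as [b'|i']; simpl; intros H H' E; try congruence.
  injection E as E. apply (f_equal (@length bool)) in E. rewrite !length_skipn in E.
  f_equal. lia.
Qed.

Definition bstep (x : list bool) (D : nat) (c c' : mconf) : Prop :=
  mstep x c c' /\ length (snd c') <= D.

Definition breach (x : list bool) (D : nat) : mconf -> mconf -> Prop :=
  clos_refl_trans _ (bstep x D).

Lemma breach_op x D o h f st h' st' :
  op_ok o -> op_pre o h f -> op_sym o (nth_error x h) ->
  h' = op_pos o h -> st' = act_app (op_act o h f) st -> length st' <= D ->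
  breach x D (h, f :: st) (h', st').
Proof. intros; subst. apply rt_step. split; auto. constructor; auto. Qed.

Lemma breach_pos x D h h' f st :
  h' <= length x -> S (length st) <= D -> breach x D (h, f :: st) (h', f :: st).
Proof.
  intros H HD. apply rt_trans with (0, f :: st).
  { apply breach_op with OZero; simpl; auto. }
  induction h' as [|h' IH]; [apply rt_refl|].
  eapply rt_trans; [apply IH; lia|].
  apply breach_op with ORight; simpl; auto.
  apply nth_error_Some. lia.
Qed.

Lemma breach_guess x D h m e r (st : list frame) (sg : nat -> sval) :
  In (m, e) L -> gsregs x r -> gsregs x sg -> S (length st) <= D ->
  exists h' r', breach x D (h, (Prove m e, r) :: st) (h', (Prove m e, r') :: st) /\
    gsregs x r' /\ (forall j, j < M -> r' (M + j) = sg j) /\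
    (forall k, k < M \/ 2 * M <= k -> r' k = r k).
Proof.
  intros HL Hr Hs HD.
  assert (H : forall J, J <= M -> exists h' r',
    breach x D (h, (Prove m e, r) :: st) (h', (Prove m e, r') :: st) /\
    gsregs x r' /\ (forall j, j < J -> r' (M + j) = sg j) /\
    (forall k, k < M \/ 2 * M <= k -> r' k = r k)).
  { induction J as [|J IH]; intros HJ.
    - exists h, r. split; [apply rt_refl|]. repeat split; auto. intros; lia.
    - destruct IH as (h1 & r1 & H1 & G1 & A1 & B1); [lia|].
      (* Storing a position leaves the head on it; storing a boolean does not move the head. *)
      exists (match sg J with SB _ => h1 | SP i => i end), (upd r1 (M + J) (sg J)).
      specialize (Hs J). split; [|split; [|split]].
      + eapply rt_trans; [exact H1|]. destruct (sg J) as [b|i] eqn:E.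
        * apply breach_op with (OGuess m e J (Some b)); simpl; auto.
        * eapply rt_trans; [apply breach_pos with (h' := i); auto|].
          apply breach_op with (OGuess m e J None); simpl; auto.
      + intros k. unfold upd. destruct (k =? M + J); auto.
      + intros j Hj. unfold upd. destruct (Nat.eqb_spec (M + j) (M + J)).
        * f_equal. lia.
        * apply A1. lia.
      + intros k Hk. unfold upd. destruct (Nat.eqb_spec k (M + J)); [lia|auto]. }
  destruct (H M) as (h' & r' & H'); [lia|]. eauto.
Qed.

(** The sizes [tl] are chosen before the registers: they depend on the derivation only, while the
    registers are guessed later. *)
Lemma argobls_holds rho es vs ts : evals p rho es vs ts ->
  exists tl, list_sum tl = ts /\ forall x (r : nat -> sval) m k,
    rho = env x r 0 m -> vs = env x r k (length es) ->
    Forall2 (obl_holds x r) (argobls m k es) tl.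
Proof.
  induction 1 as [rho|rho e es v vs t ts He Hes (tl & Hsum & IH)].
  - exists []. simpl. auto.
  - exists (t :: tl). simpl. split; [lia|]. intros x r m k Hrho Hvs.
    unfold env in Hvs. simpl in Hvs. injection Hvs as Hv Hvs.
    constructor; [|apply IH; auto].
    unfold obl_holds, obl_env. simpl. subst. exact He.
Qed.

Lemma evals_length rho es vs ts : evals p rho es vs ts -> length vs = length es.
Proof. induction 1; simpl; auto. Qed.

Lemma suffix_vals_regs x vs : Forall (is_suffix_val x) vs ->
  exists sg, gsregs x sg /\ vs = env x sg 0 (length vs).
Proof.
  induction 1 as [|v vs (s & Hs & <-) H (sg & Hg & IH)].
  - exists (fun _ => SB true). split; auto. intros k. simpl. auto.
  - exists (fun k => match k with 0 => s | S k => sg k end). split.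
    + intros [|k]; [exact Hs|apply Hg].
    + unfold env. simpl. f_equal. rewrite IH at 1.
      rewrite <- seq_shift, map_map. reflexivity.
Qed.

(** Converse of [rules_sound] with sizes: inversion of the last rule gives the scratch contents [sg]
    to guess and the head position to visit. Registers are functions, so the conclusion is stated
    for every [r'] that agrees pointwise with the result of the guess. *)
Lemma expand x t m e r :
  In (m, e) L -> gsregs x r ->
  eval p (env x r 0 m) e (dval x (r (2 * M))) t ->
  exists sg h' cks sp Os ts, gsregs x sg /\ h' <= length x /\
    In (cks, sp, Os) (rules m e) /\ sympat_ok sp (nth_error x h') /\ list_sum ts < t /\
    forall r', gsregs x r' -> (forall j, j < M -> r' (M + j) = sg j) ->
      (forall k, k < M \/ 2 * M <= k -> r' k = r k) ->
      Forall (check_holds h' r') cks /\ Forall2 (obl_holds x r') Os ts.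
Proof.
  intros HL Hr He. pose proof (L_arity _ _ HL) as Hm.
  assert (Henv : forall r', (forall k, k < M \/ 2 * M <= k -> r' k = r k) ->
     env x r' 0 m = env x r 0 m).
  { intros r' H'. apply env_ext. intros k Hk. apply H'. simpl. lia. }
  assert (HV : forall r' : nat -> sval, (forall k, k < M \/ 2 * M <= k -> r' k = r k) ->
     r' (2 * M) = r (2 * M)).
  { intros r' H'. apply H'. lia. }
  assert (HM0 : forall (r' : nat -> sval) s, (forall j, j < M -> r' (M + j) = (fun _ => s) j) ->
     r' M = s).
  { intros r' s H'. specialize (H' 0). rewrite Nat.add_0_r in H'. apply H'. lia. }
  assert (Hbool : forall b, dval x (r (2 * M)) = VB b -> r (2 * M) = SB b).
  { intros b E. apply (dval_inj x); simpl; auto. }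
  (* For the rules with one intermediate value, the constant function serves as [sg]; only register
     [M] is read. *)
  assert (Hone : forall e' v' t', eval p (env x r 0 m) e' v' t' ->
    exists s, gsval x s /\ gsregs x (fun _ => s) /\ v' = dval x s /\
      forall r', (forall j, j < M -> r' (M + j) = (fun _ => s) j) ->
       (forall k, k < M \/ 2 * M <= k -> r' k = r k) -> obl_holds x r' (mkObl false m e' M) t').
  { intros e' v' t' E. destruct (proj1 (eval_suffix x) _ _ _ _ E) as (s & Hs & <-).
    { apply gsregs_env; auto. }
    exists s. repeat split; auto. { intros k; auto. }
    intros r' H1 H2. unfold obl_holds, obl_env. simpl.
    rewrite (Henv r' H2), (HM0 r' s H1). exact E. }
  assert (Hcons : forall s b l, gsval x s -> VL (b :: l) = dval x s ->
    exists i, s = SP i /\ i < length x /\ nth_error x i = Some b /\ l = skipn (S i) x).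
  { intros [b'|i] b l Hs E; simpl in *; [discriminate|]. injection E as E.
    exists i. assert (i < length x).
    { destruct (Nat.lt_ge_cases i (length x)); auto. rewrite skipn_all2 in E by lia. discriminate. }
    destruct (nth_error x i) as [c|] eqn:Ex.
    - rewrite (skipn_nth_error _ _ _ Ex) in E. injection E as -> ->. auto.
    - apply nth_error_None in Ex. lia. }
  assert (Hnil : forall s, gsval x s -> VL [] = dval x s -> s = SP (length x)).
  { intros s Hs E. apply (dval_inj x); auto; simpl; [lia|]. now rewrite skipn_all. }
  assert (Hend : nth_error x (length x) = None) by (apply nth_error_None; lia).
  remember (env x r 0 m) as rho eqn:Erho. remember (dval x (r (2 * M))) as v eqn:Ev.
  assert (Htriv : gsregs x (fun _ => SB true)) by (intros k; simpl; auto).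
  unfold rules; cbv zeta.
  inversion He; subst e t; try subst rho0; try subst v0;
    try match goal with H : _ = v |- _ => symmetry in H end. 
  - exists (fun _ => SB true), 0, [CConst (2 * M) true], SAny, [], [].
    repeat split; simpl; auto; try lia.
    constructor; auto. simpl. rewrite HV; auto.
  - exists (fun _ => SB true), 0, [CConst (2 * M) false], SAny, [], [].
    repeat split; simpl; auto; try lia.
    constructor; auto. simpl. rewrite HV; auto.
  - exists (fun _ => SB true), (length x), [CHere (2 * M)], SEnd, [], [].
    repeat split; simpl; auto; try lia.
    constructor; auto. simpl. rewrite HV by auto. apply Hnil; auto. congruence.
  - assert (Hi : i < m).
    { apply nth_error_lt in H. rewrite Erho in H. unfold env in H.
      now rewrite length_map, length_seq in H. }
    rewrite Erho, nth_error_env in H by auto. injection H as H.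
    destruct (Nat.ltb_spec i m) as [_|]; [|lia].
    exists (fun _ => SB true), 0, [CEq (2 * M) i], SAny, [], [].
    repeat split; simpl; auto; try lia.
    constructor; auto. simpl. rewrite HV by auto. match goal with H : forall k, _ \/ _ -> _ |- _ => rewrite H by lia end.
    apply (dval_inj x); auto. congruence.
  - rename H into E. destruct (Hone _ _ _ E) as (s & Hs & Hsr & Es & Hobl).
    assert (s = SB b) as -> by (apply (dval_inj x); simpl; auto).
    exists (fun _ => SB b), 0, [CConst (2 * M) (negb b); CConst M b], SAny, [mkObl false m e0 M], [t0].
    repeat split; simpl; auto; try lia.
    + destruct b; auto.
    + constructor; [|constructor]; simpl; auto. rewrite HV; auto.
  - rename H into E. destruct (Hone _ _ _ E) as (s & Hs & Hsr & Es & Hobl).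
    assert (s = SP (length x)) as -> by auto.
    exists (fun _ => SP (length x)), (length x), [CConst (2 * M) true; CHere M], SEnd,
      [mkObl false m e0 M], [t0].
    repeat split; simpl; auto; try lia.
    constructor; [|constructor]; simpl; auto. rewrite HV; auto.
  - rename H into E. destruct (Hone _ _ _ E) as (s & Hs & Hsr & Es & Hobl).
    destruct (Hcons _ _ _ Hs Es) as (i & -> & Hi & Hx & _).
    exists (fun _ => SP i), i, [CConst (2 * M) false; CHere M], SMore, [mkObl false m e0 M], [t0].
    repeat split; simpl; auto; try lia.
    + congruence.
    + constructor; [|constructor]; simpl; auto. rewrite HV; auto.
  - rename H into E. destruct (Hone _ _ _ E) as (s & Hs & Hsr & Es & Hobl).
    destruct (Hcons _ _ _ Hs Es) as (i & -> & Hi & Hx & _).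
    exists (fun _ => SP i), i, [CConst (2 * M) b; CHere M], (SBit b), [mkObl false m e0 M], [t0].
    repeat split; simpl; auto; try lia.
    + destruct b; auto.
    + constructor; [|constructor]; simpl; auto. rewrite HV; auto.
  - rename H into E. destruct (Hone _ _ _ E) as (s & Hs & Hsr & Es & Hobl).
    destruct (Hcons _ _ _ Hs Es) as (i & -> & Hi & Hx & ->).
    exists (fun _ => SP i), i, [CSucc (2 * M); CHere M], SMore, [mkObl false m e0 M], [t0].
    repeat split; simpl; auto; try lia.
    + congruence.
    + constructor; [|constructor]; simpl; auto. rewrite HV by auto.
      apply (dval_inj x); [apply Hr|exact Hi|]. rewrite <- Ev, H2. reflexivity.
  - rename H into E. destruct (Hone _ _ _ E) as (s & Hs & Hsr & Es & Hobl).
    assert (s = SB true) as -> by (apply (dval_inj x); simpl; auto).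
    exists (fun _ => SB true), 0, [CConst M true], SAny,
      [mkObl false m e0 M; mkObl false m e1 (2 * M)], [t0; t1].
    repeat split; simpl; auto; try lia.
    + constructor; [|constructor]; simpl; auto.
    + constructor; auto. constructor; auto. unfold obl_holds, obl_env; simpl.
      rewrite Henv, HV, <- Ev by auto. auto.
  - rename H into E. destruct (Hone _ _ _ E) as (s & Hs & Hsr & Es & Hobl).
    assert (s = SB false) as -> by (apply (dval_inj x); simpl; auto).
    exists (fun _ => SB false), 0, [CConst M false], SAny,
      [mkObl false m e0 M; mkObl false m e2 (2 * M)], [t0; t2].
    repeat split; simpl; auto; try lia.
    + constructor; [|constructor]; simpl; auto.
    + constructor; auto. constructor; auto. unfold obl_holds, obl_env; simpl.
      rewrite Henv, HV, <- Ev by auto. auto.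
  - rename H into Ef, H0 into El, H1 into Ees, H2 into Eb.
    assert (Hvs : Forall (is_suffix_val x) vs).
    { eapply (proj2 (eval_suffix x)); eauto. rewrite Erho. apply gsregs_env; auto. }
    destruct (suffix_vals_regs x vs Hvs) as (sg & Hsg & Evs).
    rewrite (evals_length _ _ _ _ Ees) in Evs.
    destruct (argobls_holds _ _ _ _ Ees) as (tl & Hsum & Hargs).
    assert (Hin : In ([], SAny, argobls m M es ++ [mkObl true m0 body (2 * M)])
                     (rules m (ECall f es))).
    { unfold rules. rewrite Ef, El, Nat.eqb_refl. simpl. auto. }
    assert (Hm0 : m0 <= M).
    { destruct (L_closed _ _ _ _ _ HL Hin) as [_ HF]. apply Forall_elt in HF.
      apply (L_arity m0 body). apply HF. }
    exists sg, 0, [], SAny, (argobls m M es ++ [mkObl true m0 body (2 * M)]), (tl ++ [tb]).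
    split; [auto|split; [lia|split; [exact Hin|split; [simpl; auto|split]]]].
    + rewrite list_sum_app. simpl. lia.
    + intros r' Hr' H1 H2. split; [constructor|].
      assert (Hvs' : vs = env x r' M (length es)).
      { rewrite Evs. apply env_ext. intros k Hk. symmetry. apply H1. lia. }
      apply Forall2_app.
      * apply Hargs; auto. symmetry. auto.
      * constructor; [|constructor]. unfold obl_holds, obl_env. simpl.
        rewrite HV by auto. rewrite <- El, <- Hvs', <- Ev. exact Eb.
Qed.

(* While two obligations remain, the one with the smaller derivation is pushed: it has at most half of the total size, which pays for the additional stack frame. The last obligation reuses the current frame. *)
Lemma complete_pend x D T :
  (forall t m e r h (st : list frame), t < T -> In (m, e) L -> gsregs x r -> h <= length x ->
    eval p (env x r 0 m) e (dval x (r (2 * M))) t ->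
    length st + 1 + Nat.log2 t <= D ->
    exists h', h' <= length x /\ breach x D (h, (Prove m e, r) :: st) (h', st)) ->
  forall n Os ts r h (st : list frame), length Os <= n -> obls_ok Os -> gsregs x r -> h <= length x ->
    Forall2 (obl_holds x r) Os ts -> list_sum ts < T ->
    length st + 1 + Nat.log2 T <= D ->
    exists h', h' <= length x /\ breach x D (h, (Pend Os, r) :: st) (h', st).
Proof.
  intros IH. induction n as [|n IHn]; intros Os ts r h st Hn Hok Hr Hh HF Hsum HD.
  { destruct Os; [|simpl in Hn; lia]. exists h. split; auto.
    apply breach_op with OPop; simpl; auto. lia. }
  assert (Hgo : forall o t st', obl_ok o -> obl_holds x r o t -> t < T ->
     length st' + 1 + Nat.log2 t <= D ->
     exists h', h' <= length x /\ breach x D (h, enter o r :: st') (h', st')).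
  { intros o t st' [Ho1 Ho2] Ht HtT Hd. eapply IH; eauto.
    - intros k. apply Hr.
    - apply enter_holds; auto. eapply L_arity; eauto. }
  assert (Hpush : forall O1 o O2 t ts', Os = O1 ++ o :: O2 -> obl_holds x r o t -> 2 * t < T ->
     Forall2 (obl_holds x r) (O1 ++ O2) ts' -> list_sum ts' < T ->
     exists h', h' <= length x /\ breach x D (h, (Pend Os, r) :: st) (h', st)).
  { intros O1 o O2 t ts' -> Ht HtT HF' Hsum'.
    assert (Hlog : S (Nat.log2 t) <= Nat.log2 T).
    (* A derivation has at least one node; for [t = 0] halving would not lower the logarithm. *)
    { destruct (Nat.eq_dec t 0) as [->|].
      - exfalso. unfold obl_holds in Ht. inversion Ht.
      - rewrite <- Nat.log2_double by lia. apply Nat.log2_le_mono. lia. }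
    destruct Hok as [Hlen Hall].
    destruct (Hgo o t ((Pend (O1 ++ O2), r) :: st)) as (h1 & Hh1 & Hr1); auto.
    { eapply Forall_elt; eauto. } { lia. } { simpl. lia. }
    rewrite length_app in Hlen, Hn. simpl in Hlen, Hn.
    destruct (IHn (O1 ++ O2) ts' r h1 st) as (h2 & Hh2 & Hr2); auto.
    { rewrite length_app. lia. }
    { split. - rewrite length_app. lia.
      - apply Forall_app in Hall. destruct Hall as [H1 H2]. inversion H2; subst.
        apply Forall_app. auto. }
    exists h2. split; auto. eapply rt_trans; [|exact Hr2]. eapply rt_trans; [|exact Hr1].
    apply breach_op with (OPush O1 o O2); simpl; auto; [|lia].
    split; auto. rewrite length_app. simpl. lia. }
  inversion HF as [|o1 t1 Os1 ts1 Ho1 HF1 E1 E2]; subst.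
  { exists h. split; auto. apply breach_op with OPop; simpl; auto. lia. }
  inversion HF1 as [|o2 t2 Os2 ts2 Ho2 HF2 E1 E2]; subst.
  - simpl in Hsum.
    destruct (Hgo o1 t1 st) as (h1 & Hh1 & Hr1); auto.
    { destruct Hok as [_ Hok]. inversion Hok; auto. } { lia. }
    { assert (Nat.log2 t1 <= Nat.log2 T) by (apply Nat.log2_le_mono; lia). lia. }
    exists h1. split; auto. eapply rt_trans; [|exact Hr1].
    apply breach_op with (OTail o1); simpl; auto. lia.
  (* Comparing the first two is enough: the smaller is at most half of their sum, whatever else is
     pending. *)
  - simpl in Hsum. destruct (Nat.le_gt_cases t1 t2).
    + apply (Hpush [] o1 (o2 :: Os2) t1 (t2 :: ts2)); auto; simpl; lia.
    + apply (Hpush [o1] o2 Os2 t2 (t1 :: ts2)); auto; simpl; try lia.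
      constructor; auto.
Qed.

(** The capacity counts the frames below, the goal itself, and one frame for each possible halving
    of [t]; [T] only drives strong induction on the size. *)
Lemma complete_prove x D : forall T t m e r h (st : list frame), t < T -> In (m, e) L -> gsregs x r ->
  h <= length x -> eval p (env x r 0 m) e (dval x (r (2 * M))) t ->
  length st + 1 + Nat.log2 t <= D ->
  exists h', h' <= length x /\ breach x D (h, (Prove m e, r) :: st) (h', st).
Proof.
  induction T as [|T IH]; intros t m e r h st HT HL Hr Hh He HD; [lia|].
  destruct (expand x t m e r HL Hr He)
    as (sg & h1 & cks & sp & Os & ts & Hsg & Hh1 & Hin & Hsp & Hsum & Hall).
  destruct (breach_guess x D h m e r st sg HL Hr Hsg) as (h2 & r' & Hre & Hr' & A & B); [lia|].
  destruct (Hall r' Hr' A B) as [Hcks Hobls].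
  destruct (complete_pend x D t) with (n := length Os) (Os := Os) (ts := ts)
    (r := r') (h := h1) (st := st) as (h3 & Hh3 & Hr3); auto.
  { intros. eapply IH; eauto. lia. }
  { eapply L_closed; eauto. }
  exists h3. split; auto. eapply rt_trans; [exact Hre|].
  eapply rt_trans; [apply breach_pos with (h' := h1); auto; lia|].
  eapply rt_trans; [|exact Hr3].
  apply breach_op with (OExp m e cks sp Os); simpl; auto. lia.
Qed.

End Machine.

(** * Tape encoding of stacks *)

(* A boolean fills its whole register with one symbol that is not a bit, so comparing registers digit by digit separates booleans from positions. *)
Inductive digit : Type := DB (b : bool) | DP (b : bool).

Definition digc (c : nat) (s : sval) : digit :=
  match s with SB b => DB b | SP i => DP (Nat.testbit i c) end.

Definition fits (W : nat) (s : sval) : Prop :=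
  match s with SB _ => True | SP i => i < 2 ^ W end.

(* Carry into binary digit [c] when [h] is incremented. *)
Fixpoint carry (c h : nat) : bool :=
  match c with 0 => true | S c => Nat.odd h && carry c (Nat.div2 h) end.

(** [carry] recurses from the low end of [h]; a sweep needs the carry out of column [c] from the
    carry into it. *)
Lemma carry_S c h : carry (S c) h = Nat.testbit h c && carry c h.
Proof.
  revert h. induction c as [|c IH]; intros h.
  - simpl. reflexivity.
  - change (carry (S (S c)) h) with (Nat.odd h && carry (S c) (Nat.div2 h)).
    rewrite IH. change (carry (S c) h) with (Nat.odd h && carry c (Nat.div2 h)).
    change (Nat.testbit h (S c)) with (Nat.testbit (Nat.div2 h) c).
    destruct (Nat.odd h), (Nat.testbit (Nat.div2 h) c); reflexivity.
Qed.

Lemma div2_S h : Nat.div2 (S h) = if Nat.odd h then S (Nat.div2 h) else Nat.div2 h.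
Proof.
  pose proof (Nat.div2_odd h) as H1. pose proof (Nat.div2_odd (S h)) as H2.
  rewrite Nat.odd_succ, <- Nat.negb_odd in H2.
  destruct (Nat.odd h); simpl Nat.b2n in *; simpl negb in *; simpl Nat.b2n in *; lia.
Qed.

Lemma testbit_succ c h : Nat.testbit (S h) c = xorb (Nat.testbit h c) (carry c h).
Proof.
  revert h. induction c as [|c IH]; intros h.
  - cbn [Nat.testbit carry]. rewrite Nat.odd_succ, <- Nat.negb_odd. destruct (Nat.odd h); reflexivity.
  - change (Nat.testbit (S h) (S c)) with (Nat.testbit (Nat.div2 (S h)) c).
    change (Nat.testbit h (S c)) with (Nat.testbit (Nat.div2 h) c).
    change (carry (S c) h) with (Nat.odd h && carry c (Nat.div2 h)).
    rewrite div2_S. destruct (Nat.odd h); simpl andb; [apply IH|now rewrite Bool.xorb_false_r].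
Qed.

(** The carry out of the last column is how a finished sweep notices overflow. *)
Lemma carry_false W h : h < 2 ^ W -> carry W h = negb (S h <? 2 ^ W).
Proof.
  revert h. induction W as [|W IH]; intros h H.
  - simpl in *. assert (h = 0) by lia. subst. reflexivity.
  - change (carry (S W) h) with (Nat.odd h && carry W (Nat.div2 h)).
    pose proof (Nat.div2_odd h) as H1. rewrite Nat.pow_succ_r' in *.
    rewrite IH by (destruct (Nat.odd h); simpl in *; lia).
    destruct (Nat.odd h); simpl Nat.b2n in *; simpl andb.
    + f_equal. destruct (Nat.ltb_spec (S (Nat.div2 h)) (2 ^ W)), (Nat.ltb_spec (S h) (2 * 2 ^ W)); lia.
    + destruct (Nat.ltb_spec (S h) (2 * 2 ^ W)); simpl; auto. lia.
Qed.

Lemma testbit_inj W i j : i < 2 ^ W -> j < 2 ^ W ->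
  (forall c, c < W -> Nat.testbit i c = Nat.testbit j c) -> i = j.
Proof.
  intros Hi Hj H. apply Nat.bits_inj. intros c.
  destruct (Nat.lt_ge_cases c W); auto.
  assert (Hb : forall a, a < 2 ^ W -> Nat.testbit a c = false).
  { intros a Ha. rewrite Nat.testbit_odd, Nat.shiftr_div_pow2, Nat.div_small; auto.
    eapply Nat.lt_le_trans; [exact Ha|]. apply Nat.pow_le_mono_r; lia. }
  now rewrite !Hb.
Qed.

(** Column 0 already tells booleans from positions, whence [1 <= W]. *)
Lemma digc_inj W s s' : 1 <= W -> fits W s -> fits W s' ->
  (forall c, c < W -> digc c s = digc c s') -> s = s'.
Proof.
  intros HW Hs Hs' H. pose proof (H 0 HW) as H0.
  destruct s as [b|i], s' as [b'|j]; simpl in H0; try discriminate.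
  - congruence.
  - f_equal. apply (testbit_inj W); auto. intros c Hc. specialize (H c Hc). simpl in H. congruence.
Qed.

(** Each column repeats the control part of the frame, so every column head can be checked
    locally. *)
Definition letter : Type := (ctl * list digit)%type.

(** [Blk] carries a counter digit and the two odometer letters. In a [Cell], [mk] marks the head of
    a column, where [d] is a digit of the position register; [y = None] is a free slot. *)
Inductive cell : Type :=
| Blk (d : bool) (a b : nat)
| Ext
| Cell (mk d : bool) (y : option letter).

Inductive mode : Type :=
| MKeep
| MCarry (y : option letter)
| MPull (y : option letter).

(** At the end of a column, a frame still carried means overflow, and a frame still promised by a
    pop does not exist. *)
Definition closed (md : mode) : Prop :=
  match md with MKeep => True | MCarry y | MPull y => y = None end.

(** In [QTB] and [QTA] the flag records whether the one increment of the sweep has happened. [QMark]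
    counts: 0 before the first column, 1 after a column head, 2 after its bottom frame. [QL1] and
    [QL2] bring the input head back before [OZero]. *)
Inductive state : Type :=
| QInit
| QInc (c : bool)
| QDone
| QTB (s : bool)
| QTA (s : bool)
| QMark (s : nat)
| QL1
| QL2
| QOp (o : op) (c : bool) (md : mode)
| QAcc.

Definition get (l : list digit) (k : nat) : digit := nth k l (DB false).

Section Tape.

Variables (p : program) (M : nat) (L : list (nat * expr)) (K : nat) (body : expr).
Hypothesis M_pos : 1 <= M.
Hypothesis L_arity : forall m e, In (m, e) L -> m <= M.
Hypothesis L_closed : forall m e cks sp Os,
  In (m, e) L -> In (cks, sp, Os) (rules p M m e) -> obls_ok M L Os.
Hypothesis L_entry : In (1, body) L.

Notation R := (S (2 * M)).

(** Frames have registers for all numbers; only the first [R] are stored, which keeps the alphabet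
    finite. *)
Definition mkregs (g : nat -> digit) : list digit := map g (seq 0 R).

Lemma get_mkregs g k : k < R -> get (mkregs g) k = g k.
Proof.
  intros H. unfold get, mkregs. 
  rewrite nth_indep with (d' := g 0) by (rewrite length_map, length_seq; auto).
  rewrite map_nth, seq_nth; auto.
Qed.

Lemma mkregs_ext g g' : (forall k, k < R -> g k = g' k) -> mkregs g = mkregs g'.
Proof.
  intros H. unfold mkregs. apply map_ext_in. intros k Hk. apply in_seq in Hk. apply H. lia.
Qed.

(* The part of a frame stored in column [c]. *)
Definition letter_of (c : nat) (f : frame) : letter :=
  (fst f, mkregs (fun k => digc c (snd f k))).

Definition lcheck (cin d : bool) (l : list digit) (ck : check) : Prop :=
  match ck with
  | CConst k b => get l k = DB b
  | CEq k k' => get l k = get l k'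
  | CHere k => get l k = DP d
  | CSucc k => get l k = DP (xorb d cin)
  end.

Definition lpre (o : op) (cin d : bool) (f : letter) : Prop :=
  match o with
  | ORight | OZero => True
  | OGuess m e _ _ => fst f = Prove m e
  | OExp m e cks _ _ => fst f = Prove m e /\ Forall (lcheck cin d (snd f)) cks
  | OPush O1 o O2 => fst f = Pend (O1 ++ o :: O2)
  | OTail o => fst f = Pend [o]
  | OPop => fst f = Pend []
  | OAcc => fst f = Bot
  end.

Definition lenter (o : obl) (l : list digit) : letter :=
  (Prove (oar o) (oex o), mkregs (fun k => get l (reg_of M o k))).

Definition lact (o : op) (d : bool) (f : letter) : act letter :=
  match o with
  | ORight | OZero | OAcc => AKeep f
  | OGuess _ _ j src =>
      AKeep (fst f, mkregs (upd (get (snd f)) (M + j)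
                                (match src with Some b => DB b | None => DP d end)))
  | OExp _ _ _ _ Os => AKeep (Pend Os, snd f)
  | OPush O1 o O2 => APush (lenter o (snd f)) (Pend (O1 ++ O2), snd f)
  | OTail o => AKeep (lenter o (snd f))
  | OPop => APop
  end.

Definition ldig (o : op) (cin d : bool) : bool :=
  match o with ORight => xorb d cin | OZero => false | _ => d end.

(** With a carry out of the last column, the digits computed for [S h] would all be 0 instead of
    representing [2 ^ W]. *)
Definition lfin (o : op) (cout : bool) : Prop :=
  match o with
  | ORight => cout = false
  | OExp _ _ cks _ _ => (exists k, In (CSucc k) cks) -> cout = false
  | _ => True
  end.

Lemma ldig_spec o c h :
  ldig o (carry c h) (Nat.testbit h c) = Nat.testbit (op_pos o h) c.
Proof.
  destruct o; simpl; auto; [now rewrite testbit_succ|now rewrite Nat.bits_0].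
Qed.

Lemma reg_of_lt o k : otgt o <= 2 * M -> k < R -> reg_of M o k < R.
Proof.
  intros Ho Hk. unfold reg_of. destruct (Nat.ltb_spec k M); [destruct (osig o); lia|].
  destruct (k =? 2 * M); lia.
Qed.

Lemma lenter_spec o c (f : frame) : otgt o <= 2 * M ->
  lenter o (snd (letter_of c f)) = letter_of c (enter M o (snd f)).
Proof.
  intros Ho. unfold lenter, enter, letter_of. simpl. f_equal. apply mkregs_ext.
  intros k Hk. apply get_mkregs. apply reg_of_lt; auto.
Qed.

Lemma lact_spec o c h f : op_ok p M L o ->
  lact o (Nat.testbit h c) (letter_of c f) = act_map (letter_of c) (op_act M o h f).
Proof.
  destruct o; simpl; intros H; auto.
  - apply (f_equal (fun l => AKeep (fst f, l))). apply mkregs_ext. intros k Hk.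
    unfold upd. cbn [snd]. destruct (k =? M + j); [destruct src; reflexivity|]. now apply get_mkregs.
  - apply (f_equal (fun l => APush l _)). apply lenter_spec.
    destruct H as [_ H]. apply Forall_elt in H. apply H.
  - apply (f_equal AKeep). apply lenter_spec. destruct H as [_ H]. inversion H; subst. apply H2.
Qed.

Definition check_lt (ck : check) : Prop :=
  match ck with
  | CConst k _ | CHere k | CSucc k => k < R
  | CEq k l => k < R /\ l < R
  end.

Lemma rules_check_lt m e cks sp Os :
  In (m, e) L -> In (cks, sp, Os) (rules p M m e) -> Forall check_lt cks.
Proof.
  intros HL H. apply L_arity in HL. unfold rules in H. cbv zeta in H.
  assert (HV : 2 * M < R) by lia. assert (HM : M < R) by lia.
  remember (2 * M) as V eqn:EV.
  destruct e; cbn [map In] in H;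
    repeat match type of H with _ \/ _ => destruct H as [H|H] end; try tauto.
  4:{ destruct (Nat.ltb_spec n m); [|destruct H]. destruct H as [H|[]].
      injection H as <- <- <-. constructor; simpl; [lia|constructor]. }
  13:{ destruct (nth_error p n) as [[m' b]|]; [|destruct H].
       destruct (length l =? m'); [|destruct H]. destruct H as [H|[]].
       injection H as <- <- <-. constructor. }
  all: injection H as <- <- <-; repeat (apply Forall_cons || apply Forall_nil); simpl; lia.
Qed.

Lemma lpre_complete o c h f :
  op_ok p M L o -> op_pre o h f -> lpre o (carry c h) (Nat.testbit h c) (letter_of c f).
Proof.
  destruct o; simpl; auto. intros [HL Hr] [-> H]. split; auto.
  pose proof (rules_check_lt _ _ _ _ _ HL Hr) as Hlt.
  rewrite Forall_forall in *. intros ck Hck. specialize (H ck Hck). specialize (Hlt ck Hck).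
  destruct ck; simpl in *; rewrite ?get_mkregs by lia; rewrite H; simpl; auto.
  now rewrite testbit_succ.
Qed.

Lemma lfin_complete o W h f :
  op_pre o h f -> h < 2 ^ W -> (o = ORight -> S h < 2 ^ W) ->
  (forall k, fits W (snd f k)) -> lfin o (carry W h).
Proof.
  intros Hp Hh HR Hf. rewrite carry_false by auto.
  destruct o; simpl in *; auto.
  - specialize (HR eq_refl). now apply Nat.ltb_lt in HR as ->.
  - intros [k Hk]. destruct Hp as [_ Hp]. rewrite Forall_forall in Hp.
    specialize (Hp _ Hk). simpl in Hp. specialize (Hf k). rewrite Hp in Hf. simpl in Hf.
    now apply Nat.ltb_lt in Hf as ->.
Qed.

(** Local checks in all columns determine the registers because every compared value fits in [W]
    digits; for [S h] this is what [lfin] provides. *)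
Lemma lpre_sound o W h f :
  op_ok p M L o -> 1 <= W -> h < 2 ^ W -> (forall k, fits W (snd f k)) ->
  (forall c, c < W -> lpre o (carry c h) (Nat.testbit h c) (letter_of c f)) ->
  lfin o (carry W h) -> op_pre o h f.
Proof.
  intros Hok HW Hh Hf H Hfin. pose proof (H 0 HW) as H0.
  destruct o; simpl in *; auto.
  split; [apply H0|]. destruct Hok as [HL Hr].
  pose proof (rules_check_lt _ _ _ _ _ HL Hr) as Hlt.
  rewrite Forall_forall in *. intros ck Hck. specialize (Hlt ck Hck).
  assert (Hc : forall c, c < W -> lcheck (carry c h) (Nat.testbit h c)
                         (mkregs (fun k => digc c (snd f k))) ck).
  { intros c Hc. destruct (H c Hc) as [_ HF]. rewrite Forall_forall in HF. auto. }
  destruct ck; simpl in *.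
  - apply (digc_inj W); simpl; auto. intros c Hcc. specialize (Hc c Hcc).
    now rewrite get_mkregs in Hc.
  - apply (digc_inj W); simpl; auto. intros c Hcc. specialize (Hc c Hcc).
    now rewrite !get_mkregs in Hc by lia.
  - apply (digc_inj W); simpl; auto. intros c Hcc. specialize (Hc c Hcc).
    now rewrite get_mkregs in Hc.
  - rewrite carry_false in Hfin by auto.
    assert (HS : S h < 2 ^ W).
    { apply Nat.ltb_lt. destruct (S h <? 2 ^ W); auto. discriminate Hfin. eauto. }
    apply (digc_inj W); simpl; auto. intros c Hcc. specialize (Hc c Hcc).
    rewrite get_mkregs in Hc by auto. now rewrite testbit_succ.
Qed.

(** * Transitions *)

Definition ctl_ok (k : ctl) : Prop :=
  match k with Prove m e => In (m, e) L | Pend Os => obls_ok M L Os | Bot => True end.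

Definition letter_ok (f : letter) : Prop := ctl_ok (fst f) /\ length (snd f) <= R.

Definition slot_ok (y : option letter) : Prop := forall f, y = Some f -> letter_ok f.

Definition cell_ok (g : cell) : Prop :=
  match g with
  | Blk _ a b => a <= K /\ b <= K
  | Ext => True
  | Cell _ _ y => slot_ok y
  end.

Definition mode_ok (md : mode) : Prop :=
  match md with MKeep => True | MCarry y | MPull y => slot_ok y end.

Definition state_ok (q : state) : Prop :=
  match q with
  | QMark s => s <= 2
  | QOp o _ md => op_ok p M L o /\ mode_ok md
  | _ => True
  end.

(** Position 0 is the input itself, so register 0 is the argument of the entry function, and the
    expected result is True. All columns of these values look alike, so marking need not know the
    column number. *)
Definition regs0 : nat -> sval := fun k => if k =? 2 * M then SB true else SP 0.
Definition goal0 : frame := (Prove 1 body, regs0).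
Definition bot0 : frame := (Bot, regs0).

Inductive head_out : act letter -> option letter -> mode -> Prop :=
| ho_keep f : head_out (AKeep f) (Some f) MKeep
| ho_push f g : head_out (APush f g) (Some f) (MCarry (Some g))
| ho_pop y : head_out APop y (MPull y).

Inductive slot_out : mode -> option letter -> option letter -> mode -> Prop :=
| so_keep y : slot_out MKeep y y MKeep
| so_carry z y : slot_out (MCarry z) y z (MCarry y)
| so_pull y y' : slot_out (MPull y) y y' (MPull y').

(* [QInc]: increment the binary counter. [QTB], [QTA]: advance the low, resp. high, digit of an odometer whose two digits are the sums of the letters' [b] and [a]. [QMark]: guess where the columns start. Pushing shifts each column one cell to the right; popping shifts it to the left by guessing the next cell ([MPull]). *)
Inductive rst : state -> cell -> cell -> state -> Prop :=
| r_inc c d a b : rst (QInc c) (Blk d a b) (Blk (xorb d c) a b) (QInc (d && c))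
| r_done g : rst QDone g g QDone
| r_tb_skip s d a b : rst (QTB s) (Blk d a b) (Blk d a b) (QTB s)
| r_tb_inc d a b : b < K -> rst (QTB false) (Blk d a b) (Blk d a (S b)) (QTB true)
| r_tb_ext s : rst (QTB s) Ext Ext (QTB s)
| r_ta_skip s d a b : rst (QTA s) (Blk d a b) (Blk d a 0) (QTA s)
| r_ta_inc d a b : a < K -> rst (QTA false) (Blk d a b) (Blk d (S a) 0) (QTA true)
| r_ta_ext s : rst (QTA s) Ext Ext (QTA s)
| r_mk_head s g : s <> 1 ->
    rst (QMark s) g (Cell true false (Some (letter_of 0 goal0))) (QMark 1)
| r_mk_bot g : rst (QMark 1) g (Cell false false (Some (letter_of 0 bot0))) (QMark 2)
| r_mk_free g : rst (QMark 2) g (Cell false false None) (QMark 2)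
| r_l1 g : rst QL1 g g QL1
| r_l2 g : rst QL2 g g QL2
| r_head o c md d f y md' : closed md -> lpre o c d f -> head_out (lact o d f) y md' ->
    rst (QOp o c md) (Cell true d (Some f)) (Cell true (ldig o c d) y) (QOp o (d && c) md')
| r_slot o c md d y y' md' : slot_out md y y' md' ->
    rst (QOp o c md) (Cell false d y) (Cell false d y') (QOp o c md').

Definition op_dir (o : op) : dir := match o with ORight => DRight | _ => DStay end.

Definition grow_start (q : state) : Prop := q = QTB false \/ q = QTA false \/ q = QMark 0.

(** Both end markers read as [None]. [QL1] therefore makes one unconditional step left, after which
    [None] can only mean the left end. [OZero] is entered only by this walk, which keeps the input
    head at one plus the position register. *)
Inductive rend : state -> option bool -> option cell -> dir -> state -> Prop :=
| e_init s q : q = QInc true \/ q = QDone -> rend QInit s (Some (Blk false 0 0)) DRight q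
| e_inc c b q : q = QInc true \/ q = QDone ->
    rend (QInc c) (Some b) (if c then Some (Blk true 0 0) else None) DRight q
| e_done q : grow_start q -> rend QDone None None DStay q
| e_tb s q : grow_start q -> rend (QTB true) s (Some Ext) DStay q
| e_ta s q : grow_start q -> rend (QTA true) s (Some Ext) DStay q
| e_mark s : rend (QMark 2) s None DStay QL1
| e_l1 s : rend QL1 s None DLeft QL2
| e_l2 b : rend QL2 (Some b) None DLeft QL2
| e_l2_end : rend QL2 None None DRight (QOp OZero true MKeep)
| e_op o c md s q : closed md -> lfin o c -> op_sym o s -> o <> OAcc ->
    q = QL1 \/ (exists o', o' <> OZero /\ q = QOp o' true MKeep) ->
    rend (QOp o c md) s None (op_dir o) q
| e_acc c md s : closed md -> rend (QOp OAcc c md) s None DStay QAcc.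

(** Restricting the outputs confines the reachable words and states to finite sets. *)
Definition tst (q : state) (a b : cell) (q' : state) : Prop :=
  rst q a b q' /\ cell_ok b /\ state_ok q'.

Definition tend (q : state) (s : option bool) (g : option cell) (d : dir) (q' : state) : Prop :=
  rend q s g d q' /\ (forall a, g = Some a -> cell_ok a) /\ state_ok q'.

Notation trun := (run state cell tst).

(** * Sweeps over columns *)

Definition slots (ys : list (option letter)) : list cell := map (Cell false false) ys.

Definition colcells (d : bool) (ys : list (option letter)) : list cell :=
  match ys with [] => [] | y :: ys => Cell true d y :: slots ys end.

Definition contents (c k : nat) (st : list frame) : list (option letter) :=
  map (fun f => Some (letter_of c f)) st ++ repeat None k.

(* The free space [k] may differ from column to column: a column that overflows blocks the run, which costs completeness only. *)
Definition column (c k h : nat) (st : list frame) : list cell :=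
  colcells (Nat.testbit h c) (contents c k st).

Fixpoint cols (c : nat) (ks : list nat) (h : nat) (st : list frame) : list cell :=
  match ks with
  | [] => []
  | k :: ks => column c k h st ++ cols (S c) ks h st
  end.

(** A shift by one as a list equation, read in opposite directions for push and pop: [z'] is ejected
    at the end of the column, respectively guessed beyond it. *)
Definition slots_rel (md : mode) (ys ys' : list (option letter)) (md' : mode) : Prop :=
  match md, md' with
  | MKeep, MKeep => ys' = ys
  | MCarry z, MCarry z' => z :: ys = ys' ++ [z']
  | MPull z, MPull z' => z :: ys' = ys ++ [z']
  | _, _ => False
  end.

Lemma slots_run_sound o c md ys w r : trun (QOp o c md) (slots ys) w r ->
  exists ys' md', w = slots ys' /\ r = QOp o c md' /\ slots_rel md ys ys' md'.
Proof.
  revert md w. induction ys as [|y ys IH]; intros md w H; inversion H; subst.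
  - exists [], md. repeat split; auto. destruct md; simpl; auto.
  - destruct H3 as [H3 _]. inversion H3; subst.
    destruct (IH _ _ H6) as (ys1 & md1 & -> & -> & Hrel).
    exists (y' :: ys1), md1. repeat split; auto.
    match goal with H : slot_out _ _ _ _ |- _ => inversion H; subst end;
      destruct md1; simpl in *; try tauto; congruence.
Qed.

Lemma slots_run_complete o c md ys ys' md' :
  op_ok p M L o -> mode_ok md -> Forall slot_ok ys -> Forall slot_ok ys' -> mode_ok md' ->
  slots_rel md ys ys' md' -> trun (QOp o c md) (slots ys) (slots ys') (QOp o c md').
Proof.
  intros Ho. assert (HK : mode_ok MKeep) by exact I.
  revert md ys'. induction ys as [|y ys IH]; intros md ys' Hmd Hys Hys' Hmd' H.
  - destruct md, md'; simpl in H; try tauto.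
    + subst. constructor.
    + destruct ys' as [|z [|]]; simpl in H; try discriminate. injection H as ->. constructor.
    + destruct ys' as [|z ys']; simpl in H; try discriminate. injection H as ->. constructor.
  - inversion Hys; subst.
    destruct md as [|z|z], md' as [|z'|z']; simpl in H; try tauto.
    + subst. simpl. econstructor; [|apply (IH MKeep); auto; exact eq_refl].
      split; [|split; simpl; auto]. constructor. constructor.
    + destruct ys' as [|y' ys']; [destruct ys; discriminate|]. simpl in H. injection H as <- H.
      inversion Hys'; subst. simpl. econstructor; [|apply (IH (MCarry y)); simpl; auto].
      split; [|split; simpl; auto]. constructor. constructor.
    + destruct ys' as [|y' ys']; [destruct ys; discriminate|]. simpl in H. injection H as -> H.
      inversion Hys'; subst. simpl. econstructor; [|apply (IH (MPull y')); simpl; auto].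
      split; [|split; simpl; auto]. constructor. constructor.
Qed.

Lemma contents_snoc_none c k st : contents c k st ++ [None] = contents c (S k) st.
Proof.
  unfold contents. rewrite <- app_assoc. f_equal.
  change [None] with (repeat (@None letter) 1). rewrite <- repeat_app. f_equal. lia.
Qed.

Lemma contents_cons c k f st : contents c k (f :: st) = Some (letter_of c f) :: contents c k st.
Proof. reflexivity. Qed.

(** Frames occupy their slots with [Some], so an ejected [None] was free space. *)
Lemma contents_unsnoc c k st ys : contents c k st = ys ++ [None] ->
  exists k', k = S k' /\ ys = contents c k' st.
Proof.
  destruct k as [|k]; intros H.
  - exfalso. unfold contents in H. rewrite app_nil_r in H.
    assert (Hin : In None (map (fun f => Some (letter_of c f)) st))
      by (rewrite H, in_app_iff; simpl; auto).
    apply in_map_iff in Hin. destruct Hin as (f & Hf & _). discriminate.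
  - exists k. split; auto. rewrite <- contents_snoc_none in H.
    apply app_inj_tail in H. symmetry. apply H.
Qed.

(** Whether a column ended properly is tested only at the next column head or at the end of the
    tape, so the new contents are conditional on [closed md']. *)
Lemma col_sound o cin md c k h f st w r :
  op_ok p M L o ->
  trun (QOp o cin md) (column c k h (f :: st)) w r ->
  cin = carry c h ->
  exists md', r = QOp o (carry (S c) h) md' /\ closed md /\
    lpre o (carry c h) (Nat.testbit h c) (letter_of c f) /\
    (closed md' -> exists k', w = column c k' (op_pos o h) (act_app (op_act M o h f) st)).
Proof.
  intros Ho H Hc. unfold column in H. rewrite contents_cons in H. simpl in H.
  inversion H as [|q a b q' u v q'' [Hst _] Hrun E1 E2]; subst.
  inversion Hst; subst.
  destruct (slots_run_sound _ _ _ _ _ _ Hrun) as (ys' & md2 & -> & -> & Hrel).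
  exists md2. rewrite carry_S. repeat split; auto.
  intros Hcl. rewrite ldig_spec. rewrite lact_spec in H9 by auto.
  destruct (op_act M o h f) as [f'|f' g|]; simpl in H9; inversion H9; subst;
    destruct md2; simpl in Hrel, Hcl; try tauto; subst.
  - exists k. reflexivity.
  - change (Some (letter_of c g) :: contents c k st) with (contents c k (g :: st)) in Hrel.
    apply contents_unsnoc in Hrel. destruct Hrel as (k' & -> & ->).
    exists k'. reflexivity.
  - rewrite contents_snoc_none in Hrel. exists (S k).
    unfold column. simpl act_app. rewrite <- Hrel. reflexivity.
Qed.

Lemma cols_sound o h f st : op_ok p M L o -> forall ks c md w r,
  trun (QOp o (carry c h) md) (cols c ks h (f :: st)) w r ->
  exists md', r = QOp o (carry (c + length ks) h) md' /\
    (closed md' -> closed md /\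
      (forall c', c <= c' < c + length ks ->
         lpre o (carry c' h) (Nat.testbit h c') (letter_of c' f)) /\
      exists ks', length ks' = length ks /\
        w = cols c ks' (op_pos o h) (act_app (op_act M o h f) st)).
Proof.
  intros Ho. induction ks as [|k ks IH]; intros c md w r H.
  - inversion H; subst. exists md. simpl. rewrite Nat.add_0_r. split; auto.
    intros Hc. split; auto. split; [intros; lia|]. exists []. auto.
  - cbn [cols] in H. apply run_app_inv in H. destruct H as (v & v' & s & -> & H1 & H2).
    destruct (col_sound _ _ _ _ _ _ _ _ _ _ Ho H1 eq_refl) as (md1 & -> & Hcl & Hpre & Hw).
    destruct (IH _ _ _ _ H2) as (md' & -> & Hmd').
    exists md'. cbn [length]. rewrite <- plus_n_Sm. split; auto. intros Hc.
    destruct (Hmd' Hc) as (Hc1 & Hall & ks' & Hlen & ->).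
    destruct (Hw Hc1) as (k' & ->). split; auto. split.
    + intros c' Hc'. destruct (Nat.eq_dec c' c) as [->|]; auto. apply Hall. lia.
    + exists (k' :: ks'). cbn [length cols]. auto.
Qed.

Definition frame_ok (f : frame) : Prop := ctl_ok (fst f).

Lemma letter_of_ok c f : frame_ok f -> slot_ok (Some (letter_of c f)).
Proof.
  intros H l E. injection E as <-. split; auto. simpl. unfold mkregs.
  now rewrite length_map, length_seq.
Qed.

Lemma slot_ok_none : slot_ok None.
Proof. intros f E. discriminate. Qed.

Lemma contents_ok c k st : Forall frame_ok st -> Forall slot_ok (contents c k st).
Proof.
  intros H. apply Forall_app. split.
  - induction H; constructor; auto. now apply letter_of_ok.
  - apply Forall_forall. intros y Hy. apply repeat_spec in Hy. subst. apply slot_ok_none.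
Qed.

Lemma op_act_ok o h f st : op_ok p M L o -> op_pre o h f -> Forall frame_ok (f :: st) ->
  Forall frame_ok (act_app (op_act M o h f) st).
Proof.
  intros Ho Hp HF. inversion HF as [|? ? Hf Hst]; subst.
  destruct o; simpl in *; auto; constructor; auto.
  - unfold frame_ok. simpl. destruct Ho as [HL Hr]. eapply L_closed; eauto.
  - unfold frame_ok. simpl. destruct Ho as [_ Ho]. apply Forall_elt in Ho. apply Ho.
  - constructor; auto. unfold frame_ok; simpl. destruct Ho as [Hl Ho].
    rewrite length_app in Hl. simpl in Hl. apply Forall_app in Ho. destruct Ho as [H1 H2].
    inversion H2; subst. split; [rewrite length_app; lia|]. apply Forall_app; auto.
  - unfold frame_ok. simpl. destruct Ho as [_ Ho]. inversion Ho; subst. apply H1.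
Qed.

Lemma col_complete o md c k h f st :
  op_ok p M L o -> op_pre o h f -> Forall frame_ok (f :: st) -> closed md ->
  length (act_app (op_act M o h f) st) <= k + length (f :: st) ->
  exists md' k', closed md' /\
    k' + length (act_app (op_act M o h f) st) = k + length (f :: st) /\
    trun (QOp o (carry c h) md) (column c k h (f :: st))
         (column c k' (op_pos o h) (act_app (op_act M o h f) st)) (QOp o (carry (S c) h) md').
Proof.
  intros Ho Hp HF Hcl Hlen.
  pose proof (op_act_ok o h f st Ho Hp HF) as HF'.
  pose proof (lact_spec o c h f Ho) as Hact.
  assert (Hst : Forall frame_ok st) by (inversion HF; auto).
  assert (Hhead : forall y md' ys', head_out (lact o (Nat.testbit h c) (letter_of c f)) y md' ->
    slot_ok y -> mode_ok md' -> forall md'', mode_ok md'' -> Forall slot_ok ys' ->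
    slots_rel md' (contents c k st) ys' md'' ->
    trun (QOp o (carry c h) md) (column c k h (f :: st))
      (Cell true (Nat.testbit (op_pos o h) c) y :: slots ys') (QOp o (carry (S c) h) md'')).
  { intros y md' ys' Hy Hyok Hmd' md'' Hmd'' Hys' Hrel.
    unfold column. rewrite contents_cons. cbn [colcells]. rewrite <- ldig_spec, carry_S.
    econstructor.
    - split; [|split]. + apply r_head; eauto. now apply lpre_complete.
      + exact Hyok. + simpl. auto.
    - apply slots_run_complete; auto. now apply contents_ok. }
  rewrite Hact in Hhead. 
  destruct (op_act M o h f) as [f'|f' g|]; simpl act_map in Hhead; simpl act_app in *.
  - exists MKeep, k. split; [exact I|split; [reflexivity|]].
    apply Hhead with MKeep; simpl; auto.
    + constructor.
    + apply letter_of_ok. now inversion HF'.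
    + now apply contents_ok.
  - destruct k as [|k]; [simpl in Hlen; lia|].
    inversion HF' as [|? ? Hf' Hg]; subst. inversion Hg; subst.
    exists (MCarry None), k. split; [reflexivity|split; [simpl; lia|]].
    apply Hhead with (MCarry (Some (letter_of c g))); simpl; auto.
    + constructor.
    + now apply letter_of_ok.
    + now apply letter_of_ok.
    + apply slot_ok_none.
    + apply (contents_ok c k (g :: st)); auto.
    + rewrite <- contents_snoc_none. reflexivity.
  - exists (MPull None), (S k). split; [reflexivity|split; [simpl; lia|]].
    assert (Hex : exists y ys', contents c (S k) st = y :: ys').
    { unfold contents. destruct st; simpl; eauto. }
    destruct Hex as (y & ys' & E).
    pose proof (contents_ok c (S k) st Hst) as Hall. rewrite E in Hall. inversion Hall; subst.
    unfold column. rewrite E. cbn [colcells].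
    apply Hhead with (MPull y); simpl; auto.
    + constructor.
    + apply slot_ok_none.
    + rewrite contents_snoc_none. auto.
Qed.

(** Free slots plus frames is the length of a column and never changes; [D] is a capacity that every
    column offers. *)
Lemma cols_complete o h f st D :
  op_ok p M L o -> op_pre o h f -> Forall frame_ok (f :: st) ->
  length (act_app (op_act M o h f) st) <= D ->
  forall ks c md, closed md -> Forall (fun k => D <= k + length (f :: st)) ks ->
  exists md' ks', closed md' /\ length ks' = length ks /\
    Forall (fun k => D <= k + length (act_app (op_act M o h f) st)) ks' /\
    trun (QOp o (carry c h) md) (cols c ks h (f :: st))
         (cols c ks' (op_pos o h) (act_app (op_act M o h f) st))
         (QOp o (carry (c + length ks) h) md').
Proof.
  intros Ho Hp HF HD. induction ks as [|k ks IH]; intros c md Hcl Hks.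
  - exists md, []. rewrite Nat.add_0_r. repeat split; auto. constructor.
  - inversion Hks; subst.
    destruct (col_complete o md c k h f st Ho Hp HF Hcl) as (md1 & k' & Hc1 & Hk' & Hr1); [lia|].
    destruct (IH (S c) md1 Hc1 H2) as (md' & ks' & Hc' & Hl & Hks' & Hr2).
    exists md', (k' :: ks'). split; auto. split; [simpl; auto|]. split.
    + constructor; auto. lia.
    + cbn [length cols]. rewrite <- plus_n_Sm. eapply run_app; eauto.
Qed.

Notation tstep := (sstep state cell tst tend).
Notation treach := (sreach state cell tst tend QInit).

Definition mreach (x : list bool) : mconf -> Prop :=
  clos_refl_trans _ (mstep p M L x) (0, [goal0; bot0]).

Definition st_fits (W : nat) (st : list frame) : Prop :=
  Forall (fun f : frame => forall k, fits W (snd f k)) st.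

Lemma st_fits_act W o h f st : h < 2 ^ W -> st_fits W (f :: st) ->
  st_fits W (act_app (op_act M o h f) st).
Proof.
  intros Hh H. inversion H as [|? ? Hf Hst]; subst.
  destruct o; simpl; auto; try (constructor; auto; fail).
  - constructor; auto. intros k. simpl. unfold upd.
    destruct (k =? M + j); auto. destruct src; simpl; auto.
  - constructor; [intros k; apply Hf|]. constructor; auto.
  - constructor; auto. intros k; apply Hf.
Qed.

(** * Building the tape *)

Definition blk_of (t : bool * nat * nat) : cell := Blk (fst (fst t)) (snd (fst t)) (snd t).
Definition blks (Bs : list (bool * nat * nat)) : list cell := map blk_of Bs.
Definition sumA (Bs : list (bool * nat * nat)) : nat := list_sum (map (fun t => snd (fst t)) Bs).
Definition sumB (Bs : list (bool * nat * nat)) : nat := list_sum (map snd Bs).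
Definition bounded (Bs : list (bool * nat * nat)) : Prop :=
  Forall (fun t : bool * nat * nat => snd (fst t) <= K /\ snd t <= K) Bs.

Definition counter (c w h : nat) : list (bool * nat * nat) :=
  map (fun c => (Nat.testbit h c, 0, 0)) (seq c w).

Lemma counter_length c w h : length (counter c w h) = w.
Proof. unfold counter. now rewrite length_map, length_seq. Qed.

Lemma counter_bounded c w h : bounded (counter c w h).
Proof.
  apply Forall_forall. intros t Ht. apply in_map_iff in Ht. destruct Ht as (k & <- & _).
  simpl. lia.
Qed.

Lemma sumA_counter c w h : sumA (counter c w h) = 0.
Proof. unfold sumA, counter. revert c. induction w; intros c; simpl; auto. Qed.

Lemma sumB_counter c w h : sumB (counter c w h) = 0.
Proof. unfold sumB, counter. revert c. induction w; intros c; simpl; auto. Qed.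

Lemma sum_bounded Bs : bounded Bs -> sumA Bs <= K * length Bs /\ sumB Bs <= K * length Bs.
Proof.
  induction 1 as [|[[d a] b] Bs [H1 H2] H IH]; unfold sumA, sumB in *; simpl in *; lia.
Qed.

Lemma inc_sound h w : forall c v r,
  trun (QInc (carry c h)) (blks (counter c w h)) v r ->
  v = blks (counter c w (S h)) /\ r = QInc (carry (c + w) h).
Proof.
  induction w as [|w IH]; intros c v r H; inversion H; subst; simpl.
  - now rewrite Nat.add_0_r.
  - destruct H3 as [H3 _]. inversion H3; subst. simpl in *. rewrite <- carry_S in *.
    destruct (IH _ _ _ H6) as [-> ->]. rewrite <- plus_n_Sm. split; auto.
    now rewrite testbit_succ.
Qed.

Lemma inc_complete h w : forall c,
  trun (QInc (carry c h)) (blks (counter c w h)) (blks (counter c w (S h))) (QInc (carry (c + w) h)).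
Proof.
  induction w as [|w IH]; intros c.
  - rewrite Nat.add_0_r. constructor.
  - rewrite <- plus_n_Sm. cbn [counter seq map blks].
    apply run_cons with (QInc (carry (S c) h)); [|apply IH].
    unfold blk_of. simpl fst. simpl snd. rewrite testbit_succ, carry_S.
    split; [constructor|]. simpl. repeat split; lia.
Qed.

(** The counter overflows exactly at a power of two, whose single 1 is the appended digit. *)
Lemma counter_overflow w h : h < 2 ^ w -> S h = 2 ^ w ->
  blks (counter 0 w (S h)) ++ [Blk true 0 0] = blks (counter 0 (S w) (S h)).
Proof.
  intros H1 H2. unfold counter. rewrite seq_S. rewrite map_app. unfold blks. rewrite map_app.
  f_equal. simpl. unfold blk_of. simpl. rewrite H2. now rewrite Nat.pow2_bits_true.
Qed.

Definition copies (q : state) : Prop := q = QDone \/ q = QL1 \/ q = QL2.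

Lemma copy_sound q u v r : copies q -> trun q u v r -> v = u /\ r = q.
Proof.
  intros Hq H. induction H as [|q a b q' u v q'' [Hs _] H IH]; auto.
  destruct Hq as [->|[->| ->]]; inversion Hs; subst;
    destruct IH as [-> ->]; unfold copies; auto.
Qed.

Lemma copy_complete q u : copies q -> Forall cell_ok u -> trun q u u q.
Proof.
  intros Hq H. induction H as [|g u Hg H IH]; [constructor|].
  econstructor; [|exact IH].
  destruct Hq as [->|[->| ->]]; (split; [constructor|split; simpl; auto]).
Qed.

Lemma ext_tb_sound s e v r : trun (QTB s) (repeat Ext e) v r -> v = repeat Ext e /\ r = QTB s.
Proof.
  revert v. induction e as [|e IH]; intros v H; inversion H; subst; auto.
  destruct H3 as [H3 _]. inversion H3; subst. destruct (IH _ H6) as [-> ->]. auto.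
Qed.

Lemma ext_ta_sound s e v r : trun (QTA s) (repeat Ext e) v r -> v = repeat Ext e /\ r = QTA s.
Proof.
  revert v. induction e as [|e IH]; intros v H; inversion H; subst; auto.
  destruct H3 as [H3 _]. inversion H3; subst. destruct (IH _ H6) as [-> ->]. auto.
Qed.

Lemma ext_complete q e : (exists s, q = QTB s \/ q = QTA s) ->
  trun q (repeat Ext e) (repeat Ext e) q.
Proof.
  intros [s Hq]. induction e as [|e IH]; [constructor|].
  simpl. econstructor; [|exact IH].
  destruct Hq as [->| ->]; (split; [constructor|split; simpl; auto]).
Qed.

(** The flag balances the digit sum, so a sweep from [false] to [true] adds exactly one, at
    whichever letter it was guessed. *)
Lemma tb_sound e Bs : forall s v r,
  trun (QTB s) (blks Bs ++ repeat Ext e) v r -> bounded Bs ->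
  exists Bs' s', v = blks Bs' ++ repeat Ext e /\ r = QTB s' /\ length Bs' = length Bs /\
    bounded Bs' /\ sumA Bs' = sumA Bs /\ sumB Bs' + Nat.b2n s = sumB Bs + Nat.b2n s'.
Proof.
  induction Bs as [|[[d a] b] Bs IH]; intros s v r H HB; simpl in H.
  - apply ext_tb_sound in H. destruct H as [-> ->]. exists [], s. repeat split; auto.
  - inversion HB; subst. inversion H as [|q a1 b1 q' u v1 q'' [Hs Hok] Hr E1 E2]; subst.
    unfold blk_of in Hs; simpl in Hs.
    inversion Hs; subst; destruct (IH _ _ _ Hr H3) as (Bs' & s' & -> & -> & Hl & Hb & HA & HS).
    + exists ((d, a, b) :: Bs'), s'. unfold sumA, sumB in *. simpl in *.
      repeat split; auto; try lia. constructor; auto.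
    + exists ((d, a, S b) :: Bs'), s'. unfold sumA, sumB in *. simpl in *.
      repeat split; auto; try lia. constructor; simpl; auto. lia.
Qed.

Lemma ta_sound e Bs : forall s v r,
  trun (QTA s) (blks Bs ++ repeat Ext e) v r -> bounded Bs ->
  exists Bs' s', v = blks Bs' ++ repeat Ext e /\ r = QTA s' /\ length Bs' = length Bs /\
    bounded Bs' /\ sumB Bs' = 0 /\ sumA Bs' + Nat.b2n s = sumA Bs + Nat.b2n s'.
Proof.
  induction Bs as [|[[d a] b] Bs IH]; intros s v r H HB; simpl in H.
  - apply ext_ta_sound in H. destruct H as [-> ->]. exists [], s. repeat split; auto.
  - inversion HB; subst. inversion H as [|q a1 b1 q' u v1 q'' [Hs Hok] Hr E1 E2]; subst.
    unfold blk_of in Hs; simpl in Hs.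
    inversion Hs; subst; destruct (IH _ _ _ Hr H3) as (Bs' & s' & -> & -> & Hl & Hb & HA & HS).
    + exists ((d, a, 0) :: Bs'), s'. unfold sumA, sumB in *. simpl in *.
      repeat split; auto; try lia. constructor; simpl; auto. lia.
    + exists ((d, S a, 0) :: Bs'), s'. unfold sumA, sumB in *. simpl in *.
      repeat split; auto; try lia. constructor; simpl; auto. lia.
Qed.

Lemma tb_copy e Bs : bounded Bs ->
  trun (QTB true) (blks Bs ++ repeat Ext e) (blks Bs ++ repeat Ext e) (QTB true).
Proof.
  induction 1 as [|[[d a] b] Bs [H1 H2] H IH]; simpl.
  - apply ext_complete; eauto.
  - econstructor; [|exact IH]. split; [constructor|split; simpl; auto].
Qed.

Lemma tb_complete e Bs : bounded Bs -> sumB Bs < K * length Bs ->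
  exists Bs', trun (QTB false) (blks Bs ++ repeat Ext e) (blks Bs' ++ repeat Ext e) (QTB true) /\
    length Bs' = length Bs /\ bounded Bs' /\ sumA Bs' = sumA Bs /\ sumB Bs' = S (sumB Bs).
Proof.
  induction 1 as [|[[d a] b] Bs [H1 H2] H IH]; intros Hs.
  - unfold sumB in Hs. simpl in Hs. lia.
  - simpl in *. destruct (Nat.eq_dec b K) as [->|Hb].
    + destruct IH as (Bs' & Hr & Hl & Hbd & HA & HB). { unfold sumB in *. simpl in *. lia. }
      exists ((d, a, K) :: Bs'). split; [|unfold sumA, sumB in *; simpl in *; repeat split; auto; try lia].
      * simpl. econstructor; [|exact Hr]. split; [constructor|split; simpl; auto].
      * constructor; simpl; auto.
    + exists ((d, a, S b) :: Bs).
      split; [|unfold sumA, sumB in *; simpl in *; repeat split; auto; try lia].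
      * simpl. econstructor; [|apply tb_copy; auto]. split; [apply (r_tb_inc d a b); lia|split; simpl; auto]. lia.
      * constructor; simpl; auto. lia.
Qed.

Definition clearB (t : bool * nat * nat) : bool * nat * nat := (fst (fst t), snd (fst t), 0).

Lemma ta_copy e Bs : bounded Bs ->
  trun (QTA true) (blks Bs ++ repeat Ext e) (blks (map clearB Bs) ++ repeat Ext e) (QTA true) /\
  bounded (map clearB Bs) /\ sumA (map clearB Bs) = sumA Bs /\ sumB (map clearB Bs) = 0.
Proof.
  induction 1 as [|[[d a] b] Bs [H1 H2] H (IH & IHb & IHA & IHB)]; simpl.
  - split; [apply ext_complete; eauto|]. repeat split; auto. constructor.
  - split; [|split; [|split]].
    + econstructor; [|exact IH]. split; [constructor|split; simpl; auto]. split; [exact H1|lia].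
    + constructor; simpl; auto. split; [exact H1|lia].
    + unfold sumA in *. simpl. lia.
    + unfold sumB in *. simpl. lia.
Qed.

Lemma ta_complete e Bs : bounded Bs -> sumA Bs < K * length Bs ->
  exists Bs', trun (QTA false) (blks Bs ++ repeat Ext e) (blks Bs' ++ repeat Ext e) (QTA true) /\
    length Bs' = length Bs /\ bounded Bs' /\ sumA Bs' = S (sumA Bs) /\ sumB Bs' = 0.
Proof.
  induction 1 as [|[[d a] b] Bs [H1 H2] H IH]; intros Hs.
  - unfold sumA in Hs. simpl in Hs. lia.
  - simpl in *. destruct (Nat.eq_dec a K) as [->|Ha].
    + destruct IH as (Bs' & Hr & Hl & Hbd & HA & HB). { unfold sumA in *. simpl in *. lia. }
      exists ((d, K, 0) :: Bs'). split; [|unfold sumA, sumB in *; simpl in *; repeat split; auto; try lia].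
      * simpl. econstructor; [|exact Hr]. split; [constructor|split; simpl; auto]. lia.
      * constructor; simpl; auto. lia.
    + destruct (ta_copy e Bs H) as (Hr & Hbd & HA & HB).
      exists ((d, S a, 0) :: map clearB Bs).
      split; [|unfold sumA, sumB in *; simpl in *; repeat split; auto; try lia].
      * simpl. econstructor; [|exact Hr]. split; [apply (r_ta_inc d a b); lia|split; simpl; auto]. lia.
      * now rewrite length_map.
      * constructor; simpl; auto. lia.
Qed.

Definition col0 (k : nat) : list cell :=
  Cell true false (Some (letter_of 0 goal0)) :: Cell false false (Some (letter_of 0 bot0)) ::
  repeat (Cell false false None) k.

Lemma letter_of_regs0 c k : letter_of c (k, regs0) = letter_of 0 (k, regs0).
Proof.
  unfold letter_of. f_equal. apply mkregs_ext. intros j _. simpl. unfold regs0.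
  destruct (j =? 2 * M); auto. simpl. now rewrite Nat.bits_0.
Qed.

Lemma cols0 ks : forall c, cols c ks 0 [goal0; bot0] = flat_map col0 ks.
Proof.
  induction ks as [|k ks IH]; intros c; auto. cbn [cols flat_map]. rewrite IH. f_equal.
  unfold column, contents, col0. cbn [map app colcells slots]. rewrite Nat.bits_0.
  unfold goal0, bot0. rewrite !(letter_of_regs0 c). do 2 f_equal.
  unfold slots. now rewrite map_repeat.
Qed.

(** A column may begin anywhere except directly after a column head. Ending in [QMark 2] excludes a
    last column without a bottom frame. *)
Lemma mark_sound u : forall s v, trun (QMark s) u v (QMark 2) ->
  match s with
  | 0 => exists ks, ks <> [] /\ v = flat_map col0 ks
  | 1 => exists k ks, v = Cell false false (Some (letter_of 0 bot0)) ::
                         repeat (Cell false false None) k ++ flat_map col0 ks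
  | _ => exists k ks, v = repeat (Cell false false None) k ++ flat_map col0 ks
  end.
Proof.
  induction u as [|g u IH]; intros s v H; inversion H; subst.
  - exists 0, []. reflexivity.
  - destruct H3 as [H3 _]. inversion H3; subst; specialize (IH _ _ H6); simpl in IH.
    + destruct IH as (k & ks & ->).
      assert (E : Cell true false (Some (letter_of 0 goal0))
        :: Cell false false (Some (letter_of 0 bot0))
        :: repeat (Cell false false None) k ++ flat_map col0 ks = flat_map col0 (k :: ks))
        by reflexivity.
      destruct s as [|[|s]]; [|congruence|].
      * exists (k :: ks). split; [discriminate|exact E].
      * exists 0, (k :: ks). exact E.
    + destruct IH as (k & ks & ->). exists k, ks. reflexivity.
    + destruct IH as (k & ks & ->). exists (S k), ks. reflexivity.
Qed.

Lemma goal0_ok : frame_ok goal0.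
Proof. exact L_entry. Qed.

Lemma bot0_ok : frame_ok bot0.
Proof. exact I. Qed.

Lemma mark_col s k u : s <> 1 -> length u = k + 2 -> trun (QMark s) u (col0 k) (QMark 2).
Proof.
  intros Hs Hu. destruct u as [|g [|g' u]]; simpl in Hu; try lia.
  apply run_cons with (QMark 1).
  { split; [constructor; auto|split; [|simpl; lia]]. apply letter_of_ok, goal0_ok. }
  apply run_cons with (QMark 2).
  { split; [constructor; auto|split; [|simpl; lia]]. apply letter_of_ok, bot0_ok. }
  assert (length u = k) by lia. subst k. clear.
  induction u as [|g u IH]; [constructor|]. simpl. econstructor; [|exact IH].
  split; [constructor|split; [apply slot_ok_none|simpl; lia]].
Qed.

(** Columns of exactly [D + 2] cells are cut off; the last one takes all the rest. *)
Lemma mark_complete D W : forall s u, s <> 1 -> S W * (D + 2) <= length u ->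
  exists ks, length ks = S W /\ Forall (fun k => D <= k) ks /\
    trun (QMark s) u (flat_map col0 ks) (QMark 2).
Proof.
  induction W as [|W IH]; intros s u Hs Hu.
  - exists [length u - 2]. repeat split.
    + constructor; [lia|constructor].
    + simpl. rewrite app_nil_r. apply mark_col; auto. lia.
  - rewrite <- (firstn_skipn (D + 2) u).
    destruct (IH 2 (skipn (D + 2) u)) as (ks & Hl & HF & Hr); auto.
    { rewrite length_skipn. lia. }
    exists (D :: ks). split; [simpl; auto|split; [constructor; auto|]].
    cbn [flat_map]. eapply run_app; [|exact Hr]. apply mark_col; auto.
    rewrite length_firstn. lia.
Qed.

(** * Soundness of the sweep machine *)

(** The [w] counter cells, plus the largest value of an odometer whose two digits range up to
    [K * w]. *)
Definition tape_bound (n : nat) : nat :=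
  let w := S (Nat.log2 n) in w + (K * w) * (K * w + 1) + K * w.

(** The exact binary length, with one digit for 0; the lower bound on [h] limits the space. *)
Definition width (w h : nat) : Prop := 1 <= w /\ h < 2 ^ w /\ (w = 1 \/ 2 ^ (w - 1) <= h).

Lemma width_log2 w h n : width w h -> h <= n -> w <= S (Nat.log2 n).
Proof.
  intros (H1 & H2 & [->|H3]) Hn; [lia|].
  assert (w - 1 <= Nat.log2 n).
  { apply Nat.log2_le_pow2; [|lia]. pose proof (Nat.pow_nonzero 2 (w - 1)). lia. }
  lia.
Qed.

(** In [ti_grow] the number of appended cells is at most the value of the odometer. During [ti_walk]
    the input head moves freely, so the stored position [h] and the search position [h0] are
    unrelated until [OZero] resets both. *)
Inductive tinv (x : list bool) : sconf state cell -> Prop :=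
| ti_init : tinv x (QInit, 0, [])
| ti_cnt q h w u : q = QInc true \/ q = QDone -> h <= length x -> width w h ->
    u = blks (counter 0 w h) -> tinv x (q, S h, u)
| ti_grow q i Bs e u : grow_start q -> i <= S (length x) -> length Bs <= S (Nat.log2 (length x)) ->
    bounded Bs -> e <= sumA Bs * (K * length Bs + 1) + sumB Bs ->
    u = blks Bs ++ repeat Ext e -> tinv x (q, i, u)
| ti_walk q i ks h h0 st u :
    (q = QL1 /\ i <= S (length x)) \/ (q = QL2 /\ i <= length x) \/
      (q = QOp OZero true MKeep /\ i = 1) ->
    ks <> [] -> h < 2 ^ length ks -> st_fits (length ks) st -> bottomed st ->
    mreach x (h0, st) -> u = cols 0 ks h st -> length u <= tape_bound (length x) ->
    tinv x (q, i, u)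
| ti_op o h ks st u : o <> OZero -> op_ok p M L o ->
    h <= length x -> ks <> [] -> h < 2 ^ length ks -> st_fits (length ks) st -> bottomed st ->
    mreach x (h, st) -> u = cols 0 ks h st -> length u <= tape_bound (length x) ->
    tinv x (QOp o true MKeep, S h, u)
| ti_acc i h f st u : mreach x (h, f :: st) -> fst f = Bot ->
    length u <= tape_bound (length x) -> tinv x (QAcc, i, u).

Lemma tinv_length x q i u : tinv x (q, i, u) -> length u <= tape_bound (length x).
Proof.
  intros H. inversion H; subst; auto.
  - simpl. lia.
  - unfold blks. rewrite length_map, counter_length.
    match goal with Hw : width _ _, Hh : _ <= _ |- _ => pose proof (width_log2 _ _ _ Hw Hh) end.
    unfold tape_bound. lia.
  - unfold blks. rewrite length_app, length_map, repeat_length.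
    match goal with Hb : bounded _ |- _ => destruct (sum_bounded _ Hb) as [HA HB] end.
    unfold tape_bound.
    set (w := S (Nat.log2 (length x))) in *.
    assert (K * length Bs <= K * w) by (apply Nat.mul_le_mono_l; lia).
    assert (sumA Bs * (K * length Bs + 1) <= (K * w) * (K * w + 1)) by (apply Nat.mul_le_mono; lia).
    lia.
Qed.

Lemma op_sweep_sound o h st ks v r s g d q' :
  op_ok p M L o -> ks <> [] -> h < 2 ^ length ks -> st_fits (length ks) st -> bottomed st ->
  trun (QOp o true MKeep) (cols 0 ks h st) v r -> rend r s g d q' ->
  exists f st', st = f :: st' /\ g = None /\ op_pre o h f /\ lfin o (carry (length ks) h) /\
    (exists ks', length ks' = length ks /\
       v = cols 0 ks' (op_pos o h) (act_app (op_act M o h f) st')) /\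
    ((o = OAcc /\ q' = QAcc) \/
     (o <> OAcc /\ op_sym o s /\ d = op_dir o /\
      (q' = QL1 \/ exists o', o' <> OZero /\ q' = QOp o' true MKeep))).
Proof.
  intros Ho Hks Hh Hfit Hbot Hrun Hend.
  destruct st as [|f st]. { destruct Hbot as ([|] & b & E & _); discriminate. }
  exists f, st. split; auto.
  change true with (carry 0 h) in Hrun.
  destruct (cols_sound o h f st Ho ks 0 MKeep v r Hrun) as (md' & -> & Hmd).
  simpl in Hend. simpl Nat.add in Hmd.
  assert (HW : 1 <= length ks) by (destruct ks; simpl; [congruence|lia]).
  assert (Hf : forall k, fits (length ks) (snd f k)) by (inversion Hfit; auto).
  inversion Hend; subst; destruct (Hmd) as (_ & Hall & Hv); auto; (split; [reflexivity|]).
  - split; [|split; [auto|split; [exact Hv|right; auto]]].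
    apply lpre_sound with (W := length ks); auto. intros c Hc. apply Hall. lia.
  - split; [|split; [exact I|split; [exact Hv|left; auto]]].
    apply lpre_sound with (W := length ks); auto. intros c Hc. apply Hall. lia.
Qed.

Lemma input_sym_None x i : input_sym x i = None -> i <= length x -> i = 0.
Proof.
  destruct i; simpl; auto. intros H Hi. apply nth_error_None in H. lia.
Qed.

Lemma op_pos_fits o h W : h < 2 ^ W -> lfin o (carry W h) -> op_pos o h < 2 ^ W.
Proof.
  intros Hh Hf. destruct o; simpl in *; auto; [|lia].
  rewrite carry_false in Hf by auto. apply Nat.ltb_lt. now destruct (S h <? 2 ^ W).
Qed.

Lemma mstep_intro x o h f st : op_ok p M L o -> op_pre o h f -> op_sym o (nth_error x h) ->
  mreach x (h, f :: st) -> mreach x (op_pos o h, act_app (op_act M o h f) st).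
Proof.
  intros. eapply rt_trans; [eassumption|]. apply rt_step. constructor; auto.
Qed.

Lemma goal_bot_bottomed : bottomed [goal0; bot0].
Proof. exists [goal0], bot0. repeat split. constructor; [discriminate|constructor]. Qed.

Lemma mreach_bottomed x c : mreach x c -> bottomed (snd c).
Proof.
  intros H. apply clos_rt_rtn1 in H. induction H as [|c c' H _ IH].
  - exact goal_bot_bottomed.
  - eapply mstep_bottomed; eauto.
Qed.

Lemma regs0_fits W k : fits W (regs0 k).
Proof.
  unfold regs0. destruct (k =? 2 * M); simpl; auto.
  pose proof (Nat.pow_nonzero 2 W). lia.
Qed.

Lemma mark_state s u v r : trun (QMark s) u v r -> exists s', r = QMark s'.
Proof.
  intros H. remember (QMark s) as q eqn:E.
  assert (Hq : exists s, q = QMark s) by eauto. clear E.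
  induction H as [|q a b q' u v q'' [Hs _] H IH]; auto.
  apply IH. destruct Hq as [s' ->]. inversion Hs; eauto.
Qed.

Lemma tinv_step x c c' : tinv x c -> tstep x c c' -> tinv x c'.
Proof.
  intros Hc Hs. inversion Hs as [q i u v r g d q' Hrun Hend E1 E2]; subst c c'.
  assert (Hlen : length v = length u) by (eapply run_length; eauto).
  destruct Hend as [Hend [_ Hqok]].
  inversion Hc; subst.
  - inversion Hrun; subst. inversion Hend; subst. simpl.
    change 1 with (S 0). eapply ti_cnt with (w := 1); auto; [lia|].
    repeat split; simpl; auto; lia.
  - destruct H2 as [->| ->].
    + change (QInc true) with (QInc (carry 0 h)) in Hrun.
      apply inc_sound in Hrun. destruct Hrun as [-> ->]. simpl Nat.add in Hend.
      simpl input_sym in Hend. inversion Hend; subst.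
      assert (Hh : h < length x) by (apply nth_error_Some; congruence).
      replace (move_in (length x) (S h) DRight) with (S (S h)) by (unfold move_in; lia).
      destruct H4 as (Hw1 & Hw2 & Hw3).
      rewrite carry_false by auto. destruct (Nat.ltb_spec (S h) (2 ^ w)); simpl.
      * apply ti_cnt with w; auto. { repeat split; auto. lia. } apply app_nil_r.
      * assert (S h = 2 ^ w) by lia. apply ti_cnt with (S w); auto.
        { split; [lia|split]. { simpl. lia. } right. simpl. rewrite Nat.sub_0_r. lia. }
        now apply counter_overflow.
    + apply copy_sound in Hrun; [|unfold copies; auto]. destruct Hrun as [-> ->].
      inversion Hend; subst.
      eapply ti_grow with (Bs := counter 0 w h) (e := 0); auto.
      * simpl. lia.
      * rewrite counter_length. eapply width_log2; eauto.
      * apply counter_bounded.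
      * lia.
  - destruct H2 as [->|[->| ->]].
    + apply tb_sound in Hrun; auto.
      destruct Hrun as (Bs' & s' & -> & -> & Hl & Hb & HA & HB).
      inversion Hend; subst. simpl in HB.
      eapply ti_grow with (Bs := Bs') (e := S e); auto; try lia.
      rewrite <- app_assoc. f_equal. simpl optl. now rewrite <- repeat_cons.
    + apply ta_sound in Hrun; auto.
      destruct Hrun as (Bs' & s' & -> & -> & Hl & Hb & HB & HA).
      inversion Hend; subst. simpl in HA.
      eapply ti_grow with (Bs := Bs') (e := S e); auto; try lia.
      (* Advancing the high digit early is harmless: the low digit is at most [K * length Bs], so
         the odometer value still grows by at least one. *)
      * destruct (sum_bounded _ H5) as [_ HBb]. rewrite Hl, HB.
        replace (sumA Bs') with (S (sumA Bs)) by lia. lia.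
      * rewrite <- app_assoc. f_equal. simpl optl. now rewrite <- repeat_cons.
    + apply tinv_length in Hc. destruct (mark_state _ _ _ _ Hrun) as [s' ->].
      inversion Hend; subst.
      apply mark_sound in Hrun. destruct Hrun as (ks & Hks & ->).
      simpl optl. rewrite app_nil_r.
      rewrite <- (cols0 ks 0) in *.
      apply ti_walk with (ks := ks) (h := 0) (h0 := 0) (st := [goal0; bot0]).
      * left. auto.
      * exact Hks.
      * pose proof (Nat.pow_nonzero 2 (length ks)). lia.
      * constructor; [intros k; apply regs0_fits|].
        constructor; [intros k; apply regs0_fits|constructor].
      * apply goal_bot_bottomed.
      * apply rt_refl.
      * reflexivity.
      * lia.
  - assert (Hzero : q = QOp OZero true MKeep -> i = 1 -> tinv x (q', move_in (length x) i d, v ++ optl cell g)).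
    { intros -> ->.
      destruct (op_sweep_sound OZero h st ks v r _ _ _ _ I H3 H4 H5 H6 Hrun Hend)
        as (f & st' & -> & -> & _ & _ & (ks' & Hl & ->) & [[? _]|(_ & _ & -> & Hq')]); [discriminate|].
      simpl optl in *. rewrite app_nil_r. simpl move_in.
      change (op_pos OZero h) with 0 in *.
      change (act_app (op_act M OZero h f) st') with (f :: st') in *.
      (* [OZero] ignores the old position, so the step is available from [h0] although the tape held
         [h]. *)
      assert (Hm : mreach x (0, f :: st')).
      { exact (mstep_intro x OZero h0 f st' I I I H7). }
      assert (Hks' : ks' <> []) by (destruct ks', ks; simpl in *; congruence).
      pose proof (Nat.pow_nonzero 2 (length ks')) as Hp.
      destruct Hq' as [->|(o' & Ho' & ->)].
      - apply ti_walk with (ks := ks') (h := 0) (h0 := 0) (st := f :: st'); auto; try lia.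
        + left. split; auto. lia.
        + now rewrite Hl.
      - replace (Nat.min 1 (S (length x))) with 1 by lia.
        apply ti_op with (h := 0) (ks := ks') (st := f :: st'); auto; try lia.
        + apply Hqok.
        + now rewrite Hl. }
    destruct H2 as [[-> Hi]|[[-> Hi]|[-> ->]]]; [| |now apply Hzero].
    + apply copy_sound in Hrun; [|unfold copies; auto]. destruct Hrun as [-> ->].
      inversion Hend; subst. simpl optl. rewrite app_nil_r.
      eapply ti_walk with (h0 := h0); eauto. right; left. split; auto. simpl. lia.
    + apply copy_sound in Hrun; [|unfold copies; auto]. destruct Hrun as [-> ->].
      inversion Hend; subst; simpl optl; rewrite app_nil_r.
      * eapply ti_walk with (h0 := h0); eauto. right; left. split; auto. simpl. lia.
      * eapply ti_walk with (h0 := h0); eauto. right; right. split; auto.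
        match goal with H : None = input_sym _ _ |- _ => symmetry in H; apply input_sym_None in H; auto end.
        subst i. simpl. lia.
  - destruct (op_sweep_sound o h st ks v r _ _ _ _ H3 H5 H6 H7 H8 Hrun Hend)
      as (f & st' & -> & -> & Hpre & Hfin & (ks' & Hl & ->) & Hq').
    simpl optl in *. rewrite app_nil_r.
    destruct Hq' as [[-> ->]|(Hacc & Hsym & -> & Hq')].
    { eapply ti_acc; eauto. lia. }
    pose proof (mstep_intro x o h f st' H3 Hpre Hsym H9) as Hm.
    assert (Hks' : ks' <> []) by (destruct ks', ks; simpl in *; congruence).
    pose proof (op_pos_fits o h _ H6 Hfin) as Hpos.
    pose proof (st_fits_act _ o h f st' H6 H7) as Hfit.
    rewrite <- Hl in Hpos, Hfit.
    assert (Hi : move_in (length x) (S h) (op_dir o) = S (op_pos o h) /\ op_pos o h <= length x).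
    { destruct o; cbn [op_dir op_pos op_sym] in *; try (split; [reflexivity|auto]; fail).
      - assert (h < length x) by (apply nth_error_Some; auto). unfold move_in. lia.
      - congruence. }
    destruct Hi as [-> Hi].
    destruct Hq' as [->|(o' & Ho' & ->)].
    + eapply ti_walk; eauto.
      * left. split; auto. lia.
      * exact (mreach_bottomed _ _ Hm).
      * lia.
    + eapply ti_op; eauto.
      * apply Hqok.
      * exact (mreach_bottomed _ _ Hm).
      * lia.
  - inversion Hend; subst; inversion Hrun; subst;
      match goal with H : tst QAcc _ _ _ |- _ => destruct H as [H _]; inversion H end.
Qed.

Lemma treach_tinv x c : treach x c -> tinv x c.
Proof.
  intros H. apply clos_rt_rtn1 in H. induction H as [|c c' H _ IH].
  - constructor.
  - eapply tinv_step; eauto.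
Qed.

Lemma env_regs0 x : env x regs0 0 1 = [VL x].
Proof.
  unfold env, regs0. cbn [seq map]. destruct (Nat.eqb_spec 0 (2 * M)); [lia|reflexivity].
Qed.

Lemma regs0_result : regs0 (2 * M) = SB true.
Proof. unfold regs0. now rewrite Nat.eqb_refl. Qed.

Theorem tape_sound x i u : treach x (QAcc, i, u) ->
  exists t, eval p [VL x] body (VB true) t.
Proof.
  intros H. apply treach_tinv in H. inversion H; subst.
  - match goal with Hq : _ \/ _ |- _ => destruct Hq; discriminate end.
  - match goal with Hq : grow_start _ |- _ => destruct Hq as [?|[?|?]]; discriminate end.
  - match goal with Hq : _ \/ _ \/ _ |- _ => destruct Hq as [[? _]|[[? _]|[? _]]]; discriminate end.
  - match goal with Hm : mreach _ _, Hb : fst _ = Bot |- _ =>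
      pose proof (msteps_sound p M L M_pos L_arity x _ f h st Hm goal_bot_bottomed Hb) as HF end.
    inversion HF as [|? ? Hg _]; subst. unfold frame_holds in Hg. simpl in Hg.
    rewrite env_regs0, regs0_result in Hg. exact Hg.
Qed.

(** * Completeness of the sweep machine *)

Lemma tstep_complete x q i u v r g d q' :
  treach x (q, i, u) -> trun q u v r -> rend r (input_sym x i) g d q' ->
  (forall a, g = Some a -> cell_ok a) -> state_ok q' ->
  treach x (q', move_in (length x) i d, v ++ optl cell g).
Proof.
  intros H Hr He Hg Hq. eapply rt_trans; [exact H|]. apply rt_step.
  econstructor; [exact Hr|]. split; auto.
Qed.

(** Copying sweeps need this, since [tst] also tests the cells they rewrite. *)
Lemma treach_cells x q i u : treach x (q, i, u) -> Forall cell_ok u.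
Proof.
  intros H. apply clos_rt_rtn1 in H. remember (q, i, u) as c eqn:E. revert q i u E.
  induction H as [|c c' Hs _ IH]; intros q i u E.
  - injection E as <- <- <-. constructor.
  - subst c'. inversion Hs as [q1 i1 u1 v r g d q' Hrun [_ [Hg _]] E1 E2]; subst.
    apply Forall_app. split.
    + clear - Hrun. induction Hrun as [|q a b q' u v q'' [_ [Hb _]] H IH]; constructor; auto.
    + destruct g; constructor; auto.
Qed.

(** The next state is guessed at the end of the preceding sweep, so both possible successors are
    kept; [growing] and [ready] quantify over states for the same reason. *)
Lemma count_complete x h : h <= length x ->
  exists w, 1 <= w /\ h < 2 ^ w /\
    forall q, q = QInc true \/ q = QDone -> treach x (q, S h, blks (counter 0 w h)).
Proof.
  induction h as [|h IH]; intros Hh.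
  - exists 1. repeat split; simpl; auto; [lia|]. intros q Hq.
    replace 1 with (move_in (length x) 0 DRight) by (simpl; lia).
    refine (tstep_complete x QInit 0 [] [] QInit (Some (Blk false 0 0)) DRight q _ _ _ _ _).
    + apply rt_refl.
    + constructor.
    + now constructor.
    + intros a E. injection E as <-. simpl. lia.
    + destruct Hq as [->| ->]; exact I.
  - destruct IH as (w & Hw & Hhw & Hreach); [lia|].
    assert (Hsym : exists b, nth_error x h = Some b).
    { destruct (nth_error x h) as [b|] eqn:E; eauto. apply nth_error_None in E. lia. }
    destruct Hsym as [b Hb].
    assert (Hstep : forall q, q = QInc true \/ q = QDone ->
      treach x (q, S (S h), blks (counter 0 w (S h)) ++
         optl cell (if carry w h then Some (Blk true 0 0) else None))).
    { intros q Hq. replace (S (S h)) with (move_in (length x) (S h) DRight) by (unfold move_in; lia).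
      eapply tstep_complete with (q := QInc true).
      - apply Hreach. auto.
      - apply (inc_complete h w 0).
      - simpl. rewrite Hb. now constructor.
      - intros a. destruct (carry w h); intros E; [injection E as <-; simpl; lia|discriminate].
      - destruct Hq as [->| ->]; exact I. }
    rewrite carry_false in Hstep by auto.
    destruct (Nat.ltb_spec (S h) (2 ^ w)); simpl in Hstep.
    + exists w. repeat split; auto. intros q Hq. specialize (Hstep q Hq).
      now rewrite app_nil_r in Hstep.
    + exists (S w). assert (S h = 2 ^ w) by lia. split; [lia|split; [simpl; lia|]].
      intros q Hq. rewrite <- counter_overflow; auto.
Qed.

Definition growing (x : list bool) (Bs : list (bool * nat * nat)) (e : nat) : Prop :=
  forall q, grow_start q -> treach x (q, S (length x), blks Bs ++ repeat Ext e).

Lemma grow_start_ok q : grow_start q -> state_ok q.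
Proof. intros [->|[->| ->]]; simpl; auto. Qed.

Lemma grow_B x Bs e : bounded Bs -> growing x Bs e -> forall j, sumB Bs + j <= K * length Bs ->
  exists Bs', growing x Bs' (e + j) /\ length Bs' = length Bs /\ bounded Bs' /\
    sumA Bs' = sumA Bs /\ sumB Bs' = sumB Bs + j.
Proof.
  intros HB HG. induction j as [|j IH]; intros Hj.
  - exists Bs. rewrite !Nat.add_0_r. auto.
  - destruct IH as (B1 & HG1 & Hl1 & HB1 & HA1 & HS1); [lia|].
    destruct (tb_complete (e + j) B1 HB1) as (B2 & Hr & Hl2 & HB2 & HA2 & HS2).
    { rewrite HS1, Hl1. lia. }
    exists B2. split; [|repeat split; auto; lia].
    intros q Hq. rewrite <- plus_n_Sm. simpl repeat. rewrite repeat_cons, app_assoc.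
    change (S (length x)) with (move_in (length x) (S (length x)) DStay).
    change [Ext] with (optl cell (Some Ext)).
    eapply tstep_complete with (q := QTB false).
    + apply HG1. left; auto.
    + exact Hr.
    + now constructor.
    + intros a E. injection E as <-. exact I.
    + now apply grow_start_ok.
Qed.

Lemma grow_A x Bs e : bounded Bs -> growing x Bs e -> sumA Bs < K * length Bs ->
  exists Bs', growing x Bs' (S e) /\ length Bs' = length Bs /\ bounded Bs' /\
    sumA Bs' = S (sumA Bs) /\ sumB Bs' = 0.
Proof.
  intros HB HG HA. destruct (ta_complete e Bs HB HA) as (B2 & Hr & Hl2 & HB2 & HA2 & HS2).
  exists B2. split; [|auto].
  intros q Hq. simpl repeat. rewrite repeat_cons, app_assoc.
  change (S (length x)) with (move_in (length x) (S (length x)) DStay).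
  change [Ext] with (optl cell (Some Ext)).
  eapply tstep_complete with (q := QTA false).
  - apply HG. right; left; auto.
  - exact Hr.
  - now constructor.
  - intros a E. injection E as <-. exact I.
  - now apply grow_start_ok.
Qed.

(** One unit of the high digit costs a full round of the low one and its reset, each step appending
    a cell. *)
Lemma grow_complete x Bs : bounded Bs -> growing x Bs 0 -> sumA Bs = 0 -> sumB Bs = 0 ->
  forall s, s <= K * length Bs ->
  exists Bs', growing x Bs' (s * (K * length Bs + 1)) /\ length Bs' = length Bs /\ bounded Bs' /\
    sumA Bs' = s /\ sumB Bs' = 0.
Proof.
  intros HB HG HA0 HB0. induction s as [|s IH]; intros Hs.
  - exists Bs. auto.
  - destruct IH as (B1 & HG1 & Hl1 & HB1 & HA1 & HS1); [lia|].
    destruct (grow_B x B1 _ HB1 HG1 (K * length Bs)) as (B2 & HG2 & Hl2 & HB2 & HA2 & HS2).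
    { rewrite HS1, Hl1. lia. }
    destruct (grow_A x B2 _ HB2 HG2) as (B3 & HG3 & Hl3 & HB3 & HA3 & HS3).
    { rewrite HA2, Hl2, Hl1, HA1. lia. }
    exists B3. replace (S s * (K * length Bs + 1)) with
      (S (s * (K * length Bs + 1) + K * length Bs)) by lia.
    repeat split; auto; lia.
Qed.

(** The counter width serves as the number of columns, so positions fit. At least
    [K * W * (K * W + 1)] cells then leave more than [K * K * W] for each column. *)
Lemma layout_complete x D : exists W, 1 <= W /\ length x < 2 ^ W /\
  (D + 2 <= K * K * W ->
   exists ks, length ks = W /\ Forall (fun k => D <= k) ks /\
     treach x (QL1, S (length x), cols 0 ks 0 [goal0; bot0])).
Proof.
  destruct (count_complete x (length x) (le_n _)) as (w & Hw & Hn & Hreach).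
  exists w. split; auto. split; auto. intros HD.
  set (B0 := counter 0 w (length x)) in *.
  assert (HG0 : growing x B0 0).
  { intros q Hq. simpl repeat. 
    change (S (length x)) with (move_in (length x) (S (length x)) DStay).
    change (@nil cell) with (optl cell None).
    eapply tstep_complete with (q := QDone).
    - apply Hreach. auto.
    - apply copy_complete; [unfold copies; auto|]. eapply treach_cells. apply Hreach. auto.
    - simpl. replace (nth_error x (length x)) with (@None bool); [now constructor|].
      symmetry. apply nth_error_None. lia.
    - discriminate.
    - now apply grow_start_ok. }
  assert (Hl0 : length B0 = w) by apply counter_length.
  destruct (grow_complete x B0) with (s := K * w) as (B1 & HG1 & Hl1 & HB1 & _ & _); auto.
  { apply counter_bounded. } { apply sumA_counter. } { apply sumB_counter. }
  { rewrite Hl0. lia. }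
  rewrite Hl0 in *.
  assert (HG2 : treach x (QMark 0, S (length x), blks B1 ++ repeat Ext (K * w * (K * w + 1)))).
  { apply HG1. right; right; auto. }
  destruct w as [|w]; [lia|].
  destruct (mark_complete D w 0 (blks B1 ++ repeat Ext (K * S w * (K * S w + 1))))
    as (ks & Hl & HF & Hr); auto.
  { unfold blks. rewrite length_app, length_map, repeat_length. nia. }
  exists ks. split; auto. split; auto. rewrite cols0.
  change (S (length x)) with (move_in (length x) (S (length x)) DStay).
  rewrite <- (app_nil_r (flat_map col0 ks)). change (@nil cell) with (optl cell None).
  eapply tstep_complete; [exact HG2|exact Hr|constructor|discriminate|exact I].
Qed.

Lemma walk_complete x i u : treach x (QL1, i, u) -> i <= S (length x) ->
  treach x (QOp OZero true MKeep, 1, u).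
Proof.
  intros H Hi. pose proof (treach_cells _ _ _ _ H) as Hu.
  assert (H2 : forall j, j <= length x -> treach x (QL2, j, u) ->
                treach x (QOp OZero true MKeep, 1, u)).
  { induction j as [|j IH]; intros Hj Hr.
    - replace 1 with (move_in (length x) 0 DRight) by (simpl; lia).
      rewrite <- (app_nil_r u). change (@nil cell) with (optl cell None).
      eapply tstep_complete; [exact Hr| |constructor|discriminate|repeat split].
      apply copy_complete; auto. unfold copies; auto.
    - apply IH; [lia|].
      change j with (move_in (length x) (S j) DLeft) at 1.
      rewrite <- (app_nil_r u). change (@nil cell) with (optl cell None).
      eapply tstep_complete; [exact Hr| | |discriminate|exact I].
      + apply copy_complete; auto. unfold copies; auto.
      + simpl. destruct (nth_error x j) as [b|] eqn:E; [constructor|].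
        apply nth_error_None in E. lia. }
  apply (H2 (pred i)); [lia|].
  change (pred i) with (move_in (length x) i DLeft).
  rewrite <- (app_nil_r u). change (@nil cell) with (optl cell None).
  eapply tstep_complete; [exact H| |constructor|discriminate|exact I].
  apply copy_complete; auto. unfold copies; auto.
Qed.

Definition ready (x : list bool) (h : nat) (ks : list nat) (st : list frame) : Prop :=
  forall q, q = QL1 \/ (exists o, o <> OZero /\ op_ok p M L o /\ q = QOp o true MKeep) ->
    treach x (q, S h, cols 0 ks h st).

Definition simulated (x : list bool) (W D : nat) (c : mconf) : Prop :=
  let (h, st) := c in
  h <= length x /\ st_fits W st /\ Forall frame_ok st /\
  exists ks, length ks = W /\ Forall (fun k => D <= k + length st) ks /\ ready x h ks st.

(** The input position [i] is left general because [OZero] starts at 1 while the register still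
    holds [h]. *)
Lemma op_ready x o W D h f st ks :
  op_ok p M L o -> op_pre o h f -> op_sym o (nth_error x h) -> o <> OAcc ->
  h < 2 ^ W -> length x < 2 ^ W -> st_fits W (f :: st) -> Forall frame_ok (f :: st) ->
  length (act_app (op_act M o h f) st) <= D -> length ks = W ->
  Forall (fun k => D <= k + length (f :: st)) ks -> op_pos o h <= length x ->
  forall i, treach x (QOp o true MKeep, i, cols 0 ks h (f :: st)) ->
  op_sym o (input_sym x i) -> move_in (length x) i (op_dir o) = S (op_pos o h) ->
  exists ks', length ks' = W /\
    Forall (fun k => D <= k + length (act_app (op_act M o h f) st)) ks' /\
    ready x (op_pos o h) ks' (act_app (op_act M o h f) st).
Proof.
  intros Ho Hp Hs Hacc Hh Hn Hfit HF HD Hl Hks Hpos i Hr Hsym Hi.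
  destruct (cols_complete o h f st D Ho Hp HF HD ks 0 MKeep I Hks)
    as (md' & ks' & Hc & Hl' & HF' & Hrun).
  exists ks'. split; [congruence|]. split; auto. intros q Hq.
  rewrite <- Hi. rewrite <- (app_nil_r (cols _ _ _ _)). change (@nil cell) with (optl cell None).
  eapply tstep_complete; [exact Hr|exact Hrun| |discriminate|].
  - apply e_op; auto.
    + rewrite Hl. change (0 + W) with W. eapply lfin_complete; eauto.
      * intros ->. simpl in Hpos. lia.
      * intros k. inversion Hfit; subst; auto.
    + destruct Hq as [->|(o' & H1 & _ & ->)]; eauto.
  - destruct Hq as [->|(o' & _ & H2 & ->)]; simpl; auto.
Qed.

Lemma simulated_step x W D c c' : length x < 2 ^ W ->
  simulated x W D c -> bstep p M L x D c c' -> simulated x W D c'.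
Proof.
  intros HW Hsim [Hm HD]. inversion Hm as [o h f st Ho Hp Hs E1 E2]; subst.
  (* [OAcc] leaves the search configuration unchanged, so it needs no simulation. *)
  destruct (classic (o = OAcc)) as [->|Hacc]; [exact Hsim|].
  destruct Hsim as (Hh & Hfit & HF & ks & Hl & Hks & Hready).
  assert (Hpos : op_pos o h <= length x).
  { destruct o; simpl in *; auto; [|lia].
    assert (h < length x) by (apply nth_error_Some; auto). lia. }
  simpl in HD.
  assert (Hex : exists ks', length ks' = W /\
    Forall (fun k => D <= k + length (act_app (op_act M o h f) st)) ks' /\
    ready x (op_pos o h) ks' (act_app (op_act M o h f) st)).
  { destruct (classic (o = OZero)) as [->|Hz].
    - apply (op_ready x OZero W D h f st ks) with (i := 1); auto; try lia.
      apply walk_complete with (S h); [|lia]. apply Hready. auto.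
    - apply (op_ready x o W D h f st ks) with (i := S h); auto; try lia.
      + apply Hready. right. exists o. auto.
      + destruct o; cbn [op_dir op_pos] in *; try reflexivity; try congruence.
        unfold move_in. lia. }
  destruct Hex as (ks' & H1 & H2 & H3).
  split; [exact Hpos|split; [|split]].
  - apply st_fits_act; auto. lia.
  - apply op_act_ok; auto.
  - exists ks'. auto.
Qed.

Theorem tape_complete x t :
  eval p [VL x] body (VB true) t ->
  (forall W, 1 <= W -> length x < 2 ^ W -> Nat.log2 t + 4 <= K * K * W) ->
  exists i u, treach x (QAcc, i, u).
Proof.
  (* One frame for [bot0], one for the goal, and [log2 t] for the halvings. *)
  intros He HK. set (D := 2 + Nat.log2 t).
  destruct (layout_complete x D) as (W & HW & Hn & Hlay).
  destruct Hlay as (ks & Hl & Hks & Hr). { specialize (HK W HW Hn). lia. }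
  assert (Hfit : st_fits W [goal0; bot0]).
  { constructor; [intros k; apply regs0_fits|]. constructor; [intros k; apply regs0_fits|constructor]. }
  assert (Hok : Forall frame_ok [goal0; bot0]).
  { constructor; [exact goal0_ok|]. constructor; [exact bot0_ok|constructor]. }
  assert (Hsim : simulated x W D (0, [goal0; bot0])).
  { split; [lia|split; [exact Hfit|split; [exact Hok|]]].
    apply (op_ready x OZero W D 0 goal0 [bot0] ks) with (i := 1); simpl; auto; try lia.
    - discriminate.
    - eapply Forall_impl; [|exact Hks]. simpl. intros; lia.
    - apply walk_complete with (S (length x)); auto. }
  assert (Hgs : gsregs x regs0).
  { intros k. unfold regs0. destruct (k =? 2 * M); simpl; auto. lia. }
  destruct (complete_prove p M L M_pos L_arity L_closed x D (S t) t 1 body regs0 0 [bot0])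
    as (h & Hh & Hreach); auto; try lia.
  { rewrite env_regs0, regs0_result. exact He. }
  assert (Hend : simulated x W D (h, [bot0])).
  { fold goal0 in Hreach. clear He HK Hks Hr.
    apply clos_rt_rtn1 in Hreach. induction Hreach as [|c c' Hs _ IH]; auto.
    eapply simulated_step; eauto. }
  destruct Hend as (_ & Hfit' & Hok' & ks' & Hl' & Hks' & Hready).
  destruct (cols_complete OAcc h bot0 [] D I eq_refl Hok') with (ks := ks') (c := 0) (md := MKeep)
    as (md' & ks2 & Hc & _ & _ & Hrun); simpl; auto; [unfold D; lia|].
  assert (Ha : treach x (QOp OAcc true MKeep, S h, cols 0 ks' h [bot0])).
  { apply Hready. right. exists OAcc. repeat split; auto. discriminate. }
  eexists _, _.
  eapply tstep_complete; [exact Ha|exact Hrun|apply e_acc; auto|discriminate|exact I].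
Qed.

(** * Finiteness *)

Lemma finite_digits : finite_pred (fun ds : list digit => length ds <= R).
Proof.
  destruct (finite_lists (fun _ : digit => True) R) as [l Hl].
  - exists [DB true; DB false; DP true; DP false]. intros [[]|[]] _; simpl; auto.
  - exists l. intros ds H. apply Hl. split; auto. now apply Forall_forall.
Qed.

Lemma finite_obl : finite_pred (obl_ok M L).
Proof.
  apply finite_pred_image with
    (P := fun t : bool * ((nat * expr) * nat) => True /\ (In (fst (snd t)) L /\ snd (snd t) <= 2 * M))
    (f := fun t => mkObl (fst t) (fst (fst (snd t))) (snd (fst (snd t))) (snd (snd t))).
  - apply (finite_pred_prod _ (fun t => In (fst t) L /\ snd t <= 2 * M) finite_bool).
    apply (finite_pred_prod (fun t => In t L) (fun k => k <= 2 * M)); [exists L; auto|apply finite_pred_le].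
  - intros [s m e k] [H1 H2]. exists (s, ((m, e), k)). auto.
Qed.

Lemma finite_obls : finite_pred (obls_ok M L).
Proof. apply (finite_lists _ (M + 1) finite_obl). Qed.

Lemma finite_ctl : finite_pred ctl_ok.
Proof.
  destruct finite_obls as [l Hl].
  exists (Bot :: map (fun t => Prove (fst t) (snd t)) L ++ map Pend l).
  intros [m e|Os|] H; simpl; auto; right; apply in_app_iff.
  - left. apply (in_map (fun t => Prove (fst t) (snd t)) L (m, e) H).
  - right. apply in_map. auto.
Qed.

Lemma finite_slot : finite_pred slot_ok.
Proof.
  apply finite_option. apply (finite_pred_prod _ _ finite_ctl finite_digits).
Qed.

Lemma finite_cell : finite_pred cell_ok.
Proof.
  destruct finite_slot as [ls Hs]. pose proof finite_bool as [lb Hb].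
  destruct (finite_pred_prod _ _ (finite_pred_le K) (finite_pred_le K)) as [lk Hk].
  exists (Ext :: flat_map (fun d => map (fun ab => Blk d (fst ab) (snd ab)) lk) lb ++
    flat_map (fun mk => flat_map (fun d => map (Cell mk d) ls) lb) lb).
  intros [d a b| |mk d y] H; simpl; auto; right; apply in_app_iff.
  - left. apply in_flat_map. exists d. split; auto.
    apply (in_map (fun ab => Blk d (fst ab) (snd ab)) lk (a, b)). auto.
  - right. apply in_flat_map. exists mk. split; auto.
    apply in_flat_map. exists d. split; auto. apply in_map. auto.
Qed.

Lemma finite_op : finite_pred (op_ok p M L).
Proof.
  destruct finite_obls as [lO HO]. destruct finite_obl as [lo Ho].
  destruct (finite_pred_le M) as [lj Hj].
  pose proof (finite_option _ finite_bool) as [lb Hb].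
  exists ([ORight; OZero; OPop; OAcc] ++
    flat_map (fun t => flat_map (fun j => map (OGuess (fst t) (snd t) j) lb) lj) L ++
    flat_map (fun t => map (fun r => OExp (fst t) (snd t) (fst (fst r)) (snd (fst r)) (snd r))
                           (rules p M (fst t) (snd t))) L ++
    flat_map (fun O1 => flat_map (fun o => map (OPush O1 o) lO) lo) lO ++ map OTail lo).
  intros o H. rewrite !in_app_iff.
  destruct o; simpl in H; try (left; simpl; tauto).
  - right; left. destruct H as [HL Hlt]. apply in_flat_map. exists (m, e). split; auto.
    apply in_flat_map. exists j. split; [apply Hj; lia|]. apply in_map. apply Hb. auto.
  - right; right; left. destruct H as [HL Hr]. apply in_flat_map. exists (m, e). split; auto.
    apply (in_map (fun r => OExp m e (fst (fst r)) (snd (fst r)) (snd r)) _ (cks, sp, Os) Hr).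
  - right; right; right; left. destruct H as [Hl H]. apply Forall_app in H. destruct H as [H1 H2].
    inversion H2; subst. rewrite length_app in Hl. simpl in Hl.
    apply in_flat_map. exists O1. split; [apply HO; split; auto; lia|].
    apply in_flat_map. exists o. split; auto. apply in_map. apply HO. split; auto. lia.
  - right; right; right; right. apply in_map. apply Ho. destruct H as [_ H]. now inversion H.
Qed.

Lemma finite_mode : finite_pred mode_ok.
Proof.
  destruct finite_slot as [l Hl]. exists (MKeep :: map MCarry l ++ map MPull l).
  intros [|y|y] H; simpl; auto; right; apply in_app_iff.
  - left. apply in_map. auto.
  - right. apply in_map. auto.
Qed.

Lemma finite_state : finite_pred state_ok.
Proof.
  destruct finite_op as [lo Ho]. destruct finite_mode as [lm Hm].
  exists ([QInit; QInc true; QInc false; QDone; QTB true; QTB false; QTA true; QTA false;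
           QMark 0; QMark 1; QMark 2; QL1; QL2; QAcc] ++
    flat_map (fun o => flat_map (fun md => [QOp o true md; QOp o false md]) lm) lo).
  intros q H. apply in_app_iff.
  destruct q as [|[]| |[]|[]|s| | |o c md|]; try (left; simpl; tauto).
  - left. simpl in H. destruct s as [|[|[|s]]]; simpl; try tauto. lia.
  - right. destruct H as [H1 H2]. apply in_flat_map. exists o. split; auto.
    apply in_flat_map. exists md. split; auto. destruct c; simpl; auto.
Qed.

Theorem tape_ntm : exists N : ntm, forall x,
  (forall c, reachable N x c -> space c <= tape_bound (length x) + 2) /\
  ((exists c, reachable N x c /\ cq c = accept N) <-> exists i u, treach x (QAcc, i, u)).
Proof.
  destruct finite_state as [lQ HQ]. destruct finite_cell as [lG HG].
  destruct (sweep_ntm state cell tst tend QInit QAcc lQ lG) as [N HN].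
  - intros q a b q' (_ & H1 & H2). auto.
  - intros q s o d q' (_ & H1 & H2). auto.
  - apply HQ. exact I.
  - apply HQ. exact I.
  - exists N. intros x. destruct (HN x) as [H1 H2]. split; auto.
    intros c Hc. destruct (H1 c Hc) as (q & i & u & Hr & Hs).
    apply treach_tinv, tinv_length in Hr. lia.
Qed.

End Tape.

(** * Subexpressions *)

Definition children (e : expr) : list expr :=
  match e with
  | ENot a | ENull a | EHead a | ETail a => [a]
  | EIf a b c => [a; b; c]
  | ECall _ es => es
  | _ => []
  end.

Fixpoint subs (e : expr) : list expr :=
  e :: match e with
       | ENot a | ENull a | EHead a | ETail a => subs a
       | EIf a b c => subs a ++ subs b ++ subs c
       | ECall _ es => flat_map subs es
       | _ => []
       end.

(** The generated principle gives no hypothesis for the arguments of [ECall]; an inner induction on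
    the list supplies it. *)
Lemma expr_children_ind (P : expr -> Prop) :
  (forall e, (forall e', In e' (children e) -> P e') -> P e) -> forall e, P e.
Proof.
  intros H. fix IH 1. intros e. apply H.
  destruct e as [| | |i|a|a|a|a|a b c|f es]; simpl; intros e' He'.
  1-4: destruct He'.
  1-4: destruct He' as [<-|[]]; apply IH.
  - destruct He' as [<-|[<-|[<-|[]]]]; apply IH.
  - induction es as [|a es IHes]; [destruct He'|].
    destruct He' as [<-|He']; [apply IH|exact (IHes He')].
Qed.

Lemma in_subs e b : In e (subs b) <-> e = b \/ exists b', In b' (children b) /\ In e (subs b').
Proof.
  destruct b; simpl; rewrite ?in_app_iff, ?in_flat_map; split; intros H;
    repeat match goal with
    | H : _ \/ _ |- _ => destruct H
    | H : exists _, _ |- _ => destruct H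
    | H : _ /\ _ |- _ => destruct H
    end; subst; try tauto; eauto 10.
Qed.

Lemma subs_children b : forall e e', In e (subs b) -> In e' (children e) -> In e' (subs b).
Proof.
  induction b as [b IH] using expr_children_ind. intros e e' He He'.
  apply in_subs in He. apply in_subs. right. destruct He as [->|(b' & Hb & He)].
  - exists e'. split; auto. apply in_subs. auto.
  - exists b'. split; auto. eapply IH; eauto.
Qed.

Definition goals (p : program) : list (nat * expr) :=
  flat_map (fun mb => map (pair (fst mb)) (subs (snd mb))) p.

(** The successor guarantees a scratch register for the unary operations and conditionals. *)
Definition bank (p : program) : nat := S (list_max (map fst p)).

Lemma in_goals p m e : In (m, e) (goals p) <-> exists b, In (m, b) p /\ In e (subs b).
Proof.
  unfold goals. rewrite in_flat_map. split.
  - intros ([m' b] & Hb & H). apply in_map_iff in H. destruct H as (e' & E & He).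
    simpl in *. injection E as -> ->. eauto.
  - intros (b & Hb & He). exists (m, b). split; auto. now apply in_map.
Qed.

Lemma arity_bank (p : program) m b : In (m, b) p -> m <= list_max (map fst p).
Proof.
  intros H. pose proof (proj1 (list_max_le (map fst p) _) (le_n _)) as HF.
  rewrite Forall_forall in HF. apply HF. now apply (in_map fst p (m, b)).
Qed.

Lemma goals_arity p m e : In (m, e) (goals p) -> m <= bank p.
Proof.
  intros H. apply in_goals in H. destruct H as (b & Hb & _).
  apply arity_bank in Hb. unfold bank. lia.
Qed.

Lemma argobls_spec m es : forall k,
  length (argobls m k es) = length es /\
  Forall (fun o => oar o = m /\ In (oex o) es /\ otgt o < k + length es) (argobls m k es).
Proof.
  induction es as [|e es IH]; intros k; simpl; [auto|].
  destruct (IH (S k)) as [H1 H2]. split; [lia|]. constructor; [simpl; repeat split; auto; lia|].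
  eapply Forall_impl; [|exact H2]. intros o (Ho1 & Ho2 & Ho3). repeat split; auto. lia.
Qed.

Lemma goals_closed p m e cks sp Os :
  In (m, e) (goals p) -> In (cks, sp, Os) (rules p (bank p) m e) ->
  obls_ok (bank p) (goals p) Os.
Proof.
  intros HL H.
  assert (Hch : forall e', In e' (children e) -> In (m, e') (goals p)).
  { intros e' He'. apply in_goals in HL. apply in_goals. destruct HL as (b & Hb & He).
    exists b. split; auto. eapply subs_children; eauto. }
  clear HL. assert (HM : 1 <= bank p) by (unfold bank; lia).
  unfold rules in H. cbv zeta in H. unfold obls_ok, obl_ok.
  set (V := 2 * bank p) in *. assert (HV : V = 2 * bank p) by reflexivity. clearbody V.
  destruct e as [| | |i|a|a|a|a|a b c|f es]; cbn [map In] in H;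
    repeat match type of H with _ \/ _ => destruct H as [H|H] end; try tauto.
  4:{ destruct (i <? m); [|destruct H]. destruct H as [H|[]]. injection H as <- <- <-.
      split; [simpl; lia|constructor]. }
  13:{ destruct (nth_error p f) as [[m' body]|] eqn:Ef; [|destruct H].
       destruct (Nat.eqb_spec (length es) m') as [El|]; [|destruct H]. destruct H as [H|[]].
       injection H as <- <- <-. destruct (argobls_spec m es (bank p)) as [H1 H2].
       apply nth_error_In in Ef. pose proof (arity_bank _ _ _ Ef) as Hm.
       assert (Hm' : m' < bank p) by (unfold bank; lia).
       split; [rewrite length_app; simpl; lia|]. apply Forall_app. split.
       - eapply Forall_impl; [|exact H2]. intros o (<- & Ho2 & Ho3). split; [auto|lia].
       - constructor; [|constructor]. simpl. split; [|lia].
         apply in_goals. exists body. split; auto. apply in_subs. auto. }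
  all: injection H as <- <- <-; (split; [simpl; lia|]);
    repeat (apply Forall_cons || apply Forall_nil); simpl; (split; [apply Hch; simpl; auto|lia]).
Qed.

Lemma goals_entry p m b : nth_error p 0 = Some (m, b) -> In (m, b) (goals p).
Proof.
  intros H. apply in_goals. exists b. split; [eapply nth_error_In; eauto|]. apply in_subs. auto.
Qed.

(** * Determinism, numerical bounds and conclusion *)

(** Identifies the values of three runs: the one with polynomial time, the one that decides, and the
    one read off an accepting computation. *)
Lemma eval_det p :
  (forall rho e v t, eval p rho e v t -> forall v' t', eval p rho e v' t' -> v = v') /\
  (forall rho es vs t, evals p rho es vs t -> forall vs' t', evals p rho es vs' t' -> vs = vs').
Proof.
  apply eval_evals_ind.
  all: intros.
  all: match goal with
    | H : eval _ _ _ ?v _ |- _ = ?v => inversion H; subst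
    | H : evals _ _ _ ?v _ |- _ = ?v => inversion H; subst
    end.
  all: try congruence.
  all: repeat match goal with
    | H1 : nth_error ?q ?f = Some (_, ?b1), H2 : nth_error ?q ?f = Some (_, ?b2) |- _ =>
        assert (b2 = b1) by congruence; clear H2; subst b2
    | IH : forall v' t', eval ?q ?r ?e v' t' -> _, H : eval ?q ?r ?e _ _ |- _ =>
        pose proof (IH _ _ H); clear H
    | IH : forall v' t', evals ?q ?r ?e v' t' -> _, H : evals ?q ?r ?e _ _ |- _ =>
        pose proof (IH _ _ H); clear H; subst
    end.
  all: congruence.
Qed.

(** All terms are absorbed into the square of [w = l + 1] by [w <= w * w], and
    [w * w <= 2 * (l * l) + 2] gives the factor 2. *)
Lemma tape_bound_log2 K n :
  tape_bound K n + 2 <= 2 * (K * K + 2 * K + 3) * Nat.log2 n ^ 2 + 2 * (K * K + 2 * K + 3).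
Proof.
  unfold tape_bound. set (l := Nat.log2 n). cbv zeta. rewrite Nat.pow_2_r.
  set (w := S l). set (C := K * K + 2 * K + 3).
  assert (Hw : w * w <= 2 * (l * l) + 2) by (unfold w; nia).
  assert (H1 : w <= w * w) by (unfold w; nia).
  assert (H2 : w + K * w * (K * w + 1) + K * w + 2 <= C * (w * w)).
  { replace (C * (w * w)) with (K * K * (w * w) + 2 * (K * (w * w)) + 3 * (w * w)) by (unfold C; lia).
    assert (K * w <= K * (w * w)) by (apply Nat.mul_le_mono_l; auto).
    replace (K * w * (K * w + 1)) with (K * K * (w * w) + K * w) by lia. unfold w in *. lia. }
  assert (C * (w * w) <= C * (2 * (l * l) + 2)) by (apply Nat.mul_le_mono_l; auto).
  lia.
Qed.

(** From [t <= 2 * c * 2 ^ (W * k)] follows [log2 t <= 2 * c + W * k], which is linear in [W]; the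
    square on the right is the form that the layout offers. *)
Lemma log2_time c k n t W : t <= c * n ^ k + c -> 1 <= W -> n < 2 ^ W ->
  Nat.log2 t + 4 <= (2 * c + k + 4) * (2 * c + k + 4) * W.
Proof.
  intros Ht HW Hn.
  assert (Hp : n ^ k <= 2 ^ (W * k)).
  { rewrite Nat.pow_mul_r. apply Nat.pow_le_mono_l. lia. }
  assert (Hc : 2 * c < 2 ^ (2 * c)) by (apply Nat.pow_gt_lin_r; lia).
  assert (Hpos : 1 <= 2 ^ (W * k)) by (pose proof (Nat.pow_nonzero 2 (W * k)); lia).
  assert (Hlog : Nat.log2 t <= 2 * c + W * k).
  { rewrite <- (Nat.log2_pow2 (2 * c + W * k)) by lia. apply Nat.log2_le_mono.
    rewrite Nat.pow_add_r. nia. }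
  nia.
Qed.

Theorem theorem7 :
  forall (X : list bool -> Prop) (p : program),
    wf_program p -> cf_poly p -> cf_decides p X -> in_NSPACE_log2sq X.
Proof.
  intros X p [[body Hbody] _] (c & k & Hpoly) Hdec.
  set (K := 2 * c + k + 4).
  assert (HM : 1 <= bank p) by (unfold bank; lia).
  destruct (tape_ntm p (bank p) (goals p) K body HM (goals_arity p)) as [N HN].
  exists N, (2 * (K * K + 2 * K + 3)). intros x. destruct (HN x) as [Hspace Hacc].
  split.
  { intros cf Hc. eapply Nat.le_trans; [apply Hspace; exact Hc|apply tape_bound_log2]. }
  rewrite Hacc. destruct (Hdec x) as (v & t & (b & Hb & Hv) & HX & HnX).
  assert (b = body) as -> by congruence. split.
  - intros Hx. specialize (HX Hx) as ->.
    destruct (Hpoly x) as (v' & t' & (b & Hb' & Hv') & Ht').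
    assert (b = body) as -> by congruence.
    assert (v' = VB true) as -> by (symmetry; eapply (proj1 (eval_det p)); eauto).
    eapply tape_complete; eauto; try apply goals_arity; try apply goals_closed.
    { now apply goals_entry. }
    intros W HW Hn. apply (log2_time c k (length x)); auto.
  - intros (i & u & H).
    apply tape_sound in H; auto; [|apply goals_arity].
    destruct H as [t' Ht'].
    assert (v = VB true) by (eapply (proj1 (eval_det p)); eauto).
    destruct (classic (X x)) as [|Hn]; auto. specialize (HnX Hn). congruence.
Qed.
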